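(* Let $r, d \in \mathbb{Z}_{\geq 0}$ with $r \geq 2$. Set $s = (r-1)(d+1)+2$, and let $\mathbf{r}$ denote the $(d+1)$-tuple $\mathbf{r} = (r-1, 0, 0, \dotsc, 0, 1)$. Then for all integers $a > d^2 + d$, writing $T = T^{a}_{\mathbf{r}}$ for the generalised Turán pattern, we have \[ \mathrm{ex}_\Pi\big(s, \Sigma_{T}(s)\big) = e^{\pi_{T}}. \]
   Context: A multigraph $G=(V,w)$ is a finite vertex set $V$ together with a function $w\colon \binom{V}{2}\to\mathbb{Z}_{\ge 0}$ (edge multiplicities). For $X\subseteq V$ let $e(X)=\sum_{uv\in\binom{X}{2}}w(uv)$ and $P(X)=\prod_{uv\in\binom{X}{2}}w(uv)$; write $e(G)=e(V)$, $P(G)=P(V)$. For integers $s\ge 2$, $q\ge 0$, $G$ is an $(s,q)$-graph if $e(X)\le q$ for every $s$-subset $X\subseteq V$. Let $\mathrm{ex}_\Pi(n,s,q)$ be the maximum of $P(G)$ over all $(s,q)$-graphs $G$ on vertex set $[n]$, and $\mathrm{ex}_\Pi(s,q)=\lim_{n\to\infty}\mathrm{ex}_\Pi(n,s,q)^{1/\binom{n}{2}}$ (this limit exists). A pattern $P$ on a finite set $V(P)$ assigns a non-negative integer multiplicity $P(\{v\})$ to each $v\in V(P)$ (loops) and $P(\{u,v\})$ to each pair of distinct $u,v\in V(P)$. A blow-up of $P$ on $[n]$ is a multigraph on $[n]$ for which there is a map $f\colon[n]\to V(P)$ (not necessarily surjective) with $w(vv')=P(\{f(v),f(v')\})$ for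 all distinct $v,v'$ (this is a loop multiplicity when $f(v)=f(v')$). $\Sigma_P(n)$ denotes the maximum of $e(G)$ over blow-ups $G$ of $P$ on $[n]$. Let $A'_P$ be the $V(P)\times V(P)$ matrix with $(A'_P)_{uv}=\log P(\{u,v\})$ (with $\{u,u\}=\{u\}$), and $\pi_P=\max\{\mathbf{x}^{T}A'_P\mathbf{x}: \mathbf{x}\in\mathbb{R}_{\ge0}^{V(P)},\ \sum_v x_v=1\}$. Generalised Turán pattern: given a $(d+1)$-tuple $\mathbf{r}=(r_0,\dots,r_d)$ of non-negative integers with $r_0,r_d>0$ and an integer $a$, let $R=\sum_i r_i$; $T^a_{\mathbf{r}}$ is the pattern on $[R]$ in which, for every $v\in[R]$ with $\sum_{i<j}r_i<v\le\sum_{i\le j}r_i$, the loop at $v$ has multiplicity $a-j$ and every pair $\{v,v'\}$ with $v<v'\le R$ has multiplicity $a-j+1$. *)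

(* Defs.v *)
From HB Require Import structures.
From mathcomp Require Import all_boot all_order all_algebra.
From mathcomp Require Import all_classical all_reals all_analysis.
Set Implicit Arguments.
Unset Strict Implicit.
Unset Printing Implicit Defensive.
Import Order.TTheory GRing.Theory Num.Theory.
Import numFieldNormedType.Exports.
Local Open Scope classical_set_scope.
Local Open Scope ring_scope.

(* The greatest element of [A], or [x0] when [A] has none. *)
Definition maximum (disp : Order.disp_t) (T : porderType disp) (x0 : T)
    (A : set T) : T :=
  xget x0 [set m | A m /\ ubound A m].

(* Only the values on subsets of cardinal 2 are meaningful. *)
Definition multigraph (V : finType) := {set V} -> nat.

Definition edge_sum (V : finType) (G : multigraph V) (X : {set V}) : nat :=
  (\sum_(A : {set V} | (A \subset X) && (#|A| == 2)) G A)%N.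

Definition edge_prod (V : finType) (G : multigraph V) (X : {set V}) : nat :=
  (\prod_(A : {set V} | (A \subset X) && (#|A| == 2)) G A)%N.

Definition is_sq_graph (V : finType) (s q : nat) (G : multigraph V) : Prop :=
  forall X : {set V}, #|X| = s -> (edge_sum G X <= q)%N.

(* For n < s every multigraph on 'I_n is an (s,q)-graph, so that the maximum
   may fail to exist; it exists for n >= s >= 2 (lemma [ex_prod_nP]). *)
Definition ex_prod_n (n s q : nat) : nat :=
  maximum 0%N
    [set edge_prod G [set: 'I_n]%SET | G in @is_sq_graph 'I_n s q].

(* [limn] of a divergent real sequence is 0, hence an equation between this and
   a positive real contains the convergence. *)
Definition ex_prod (R : realType) (s q : nat) : R :=
  limn (fun n : nat => (ex_prod_n n s q)%:R `^ ('C(n, 2)%:R)^-1 : R).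

(* Only the values on subsets of cardinal 1 (loops) and 2 are meaningful. *)
Definition pattern (V : finType) := {set V} -> nat.

Definition blowup (V : finType) (P : pattern V) (n : nat)
    (f : {ffun 'I_n -> V}) : multigraph 'I_n :=
  fun A => P (f @: A).

Definition Sigma (V : finType) (P : pattern V) (n : nat) : nat :=
  (\max_(f : {ffun 'I_n -> V}) edge_sum (blowup P f) [set: 'I_n]%SET)%N.

(* For u = v the set [set u; v] is [set u], giving the logarithm of the loop
   multiplicity. The library sets ln 0 = 0, so this is meant for patterns with
   positive multiplicities, such as [turan_pattern a r] when d < a. *)
Definition log_mult (R : realType) (V : finType) (P : pattern V) (u v : V) : R :=
  ln (P [set u; v]%SET)%:R.

Definition pi_pattern (R : realType) (V : finType) (P : pattern V) : R :=
  maximum 0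
    [set \sum_u \sum_v x u * log_mult R P u v * x v
      | x in [set x : V -> R | (forall v, 0 <= x v) /\ \sum_v x v = 1]].

(* The vertex v : 'I_(sumn r) stands for v + 1 in {1, ..., R}, and
   [reshape_index r v] is the j with
   r_0 + ... + r_(j-1) <= v < r_0 + ... + r_j (lemma [turan_levelP]).
   [enum A] lists the elements of A in increasing order. *)
Definition turan_pattern (a d : nat) (r : d.+1.-tuple nat) :
    pattern 'I_(sumn r) :=
  fun A =>
    match enum A with
    | [:: v] => (a - reshape_index r v)%N
    | [:: v; _] => (a - reshape_index r v + 1)%N
    | _ => 0%N
    end.
Arguments turan_pattern a {d} r.

(* (r-1, 0, ..., 0, 1), read as the one-entry tuple (r) when d = 0. *)
Definition r_tuple (r d : nat) : d.+1.-tuple nat :=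
  [tuple (r.-1 * (i == ord0) + (i == ord_max))%N | i < d.+1].

Lemma maximum_eq (disp : Order.disp_t) (T : porderType disp) (x0 m : T)
    (A : set T) :
  A m -> ubound A m -> maximum x0 A = m.
Proof.
move=> Am Um; apply: xget_subset1 => // x y [Ax Ux] [Ay Uy].
by apply/le_anti; rewrite Uy // Ux.
Qed.

Lemma blowupE (V : finType) (P : pattern V) (n : nat) (f : {ffun 'I_n -> V})
    (v v' : 'I_n) :
  blowup P f [set v; v']%SET = P [set f v; f v']%SET.
Proof. by rewrite /blowup imsetU1 imset_set1. Qed.

Lemma turan_levelP (d : nat) (r : d.+1.-tuple nat) (v : 'I_(sumn r)) :
  let j := reshape_index r v in
  (\sum_(i < d.+1 | i < j) tnth r i <= v < \sum_(i < d.+1 | i <= j) tnth r i)%N.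
Proof.
rewrite /=; set j := reshape_index r v.
have jd : (j < d.+1)%N by rewrite -(size_tuple r) reshape_indexP.
have sumE k : (k <= d.+1)%N ->
    (\sum_(i < d.+1 | i < k) tnth r i = sumn (take k r))%N.
  move=> kd; rewrite (eq_bigr (fun i : 'I_d.+1 => nth 0%N r i)); last first.
    by move=> i _; rewrite (tnth_nth 0%N).
  rewrite -(big_ord_widen _ (nth 0%N r) kd) sumnE (big_nth 0%N) size_take_min.
  rewrite size_tuple (minn_idPl kd) big_mkord.
  by apply: eq_bigr => i _; rewrite nth_take.
rewrite sumE ?(ltnW jd)// (sumE j.+1)//.
have := reshape_indexK r v; rewrite /flatten_index -/j => vE.
have := reshape_offsetP (ltn_ord v); rewrite -/j => lt_off.
rewrite -{1}vE leq_addr /= (take_nth 0%N) ?size_tuple// sumn_rcons.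
by rewrite -{1}vE ltn_add2l.
Qed.

Lemma turan_loop (a d : nat) (r : d.+1.-tuple nat) (v : 'I_(sumn r)) :
  turan_pattern a r [set v]%SET = (a - reshape_index r v)%N.
Proof. by rewrite /turan_pattern enum_set1. Qed.

Lemma turan_edge (a d : nat) (r : d.+1.-tuple nat) (v v' : 'I_(sumn r)) :
  (v < v')%N ->
  turan_pattern a r [set v; v']%SET = (a - reshape_index r v + 1)%N.
Proof.
move=> vv'; rewrite /turan_pattern.
suff -> : enum [set v; v']%SET = [:: v; v'] by [].
have ltT : transitive (fun x y : 'I_(sumn r) => (x < y)%N).
  by move=> y x z; apply: ltn_trans.
apply: (irr_sorted_eq ltT) => [x||/=|x].
- exact: ltnn.
- rewrite {1}/enum_mem; apply: sorted_filter => //.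
  by rewrite -(sorted_map (f := val) (e' := ltn)) -enumT val_enum_ord
    iota_ltn_sorted.
- by rewrite vv'.
- by rewrite mem_enum !inE.
Qed.

Lemma ex_prod_nP (n s q : nat) : (2 <= s <= n)%N ->
  let A := [set edge_prod G [set: 'I_n]%SET | G in @is_sq_graph 'I_n s q] in
  A (ex_prod_n n s q) /\ ubound A (ex_prod_n n s q).
Proof.
move=> /andP[s2 sn] A.
pose N := #|[set B : {set 'I_n} | #|B| == 2]%SET|.
have A0 : A (edge_prod (fun=> 0%N) [set: 'I_n]%SET).
  by exists (fun=> 0%N) => // X _; rewrite /edge_sum big1.
have leA k : A k -> (k <= q ^ N)%N.
  case=> G GP <-; rewrite /N -prod_nat_const /edge_prod.
  rewrite [X in (X <= _)%N](eq_bigl [in [set B : {set 'I_n} | #|B| == 2]%SET]);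
    last by move=> B; rewrite finset.subsetT !inE.
  apply: leq_prod => B; rewrite inE => /eqP B2.
  have [X BX Xs] : exists2 X : {set 'I_n}, B \subset X & #|X| = s.
    have sB : (s - 2 <= #|~: B|%SET)%N.
      by rewrite cardsCs finset.setCK card_ord B2 leq_sub2r.
    have [C CB Cs] : exists2 C : {set 'I_n}, C \subset ~: B & #|C| = (s - 2)%N.
      have /card_geqP[t [ut st tB]] := sB.
      exists [set x in t]%SET.
        by apply/fintype.subsetP => x; rewrite inE => /tB.
      by rewrite cardsE -st; apply/card_uniqP.
    exists (B :|: C)%SET; first exact: finset.subsetUl.
    rewrite cardsU B2 Cs (_ : (B :&: C)%SET = finset.set0) ?cards0 ?subn0 ?subnKC//.
    by apply/eqP; rewrite finset.setIC finset.setI_eq0 finset.disjoints_subset.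
  apply: leq_trans (GP X Xs).
  by rewrite /edge_sum (bigD1 B) ?BX ?B2//= leq_addr.
have [m Am mP] : exists2 m, A m & ubound A m.
  have exA : exists k, `[<A k>].
    by exists (edge_prod (fun=> 0%N) [set: 'I_n]%SET); apply/asboolP.
  have ubA k : `[<A k>] -> (k <= q ^ N)%N by move/asboolP/leA.
  case: (ex_maxnP exA ubA) => m /asboolP Am mP; exists m => // k Ak.
  exact/mP/asboolP.
by rewrite /ex_prod_n (maximum_eq _ Am mP).
Qed.

(* Main.v *)
Require Import Defs.
From mathcomp Require Import all_boot all_order all_algebra.
From mathcomp Require Import all_classical all_reals all_analysis.
From mathcomp Require Import zify ring lra.
Set Implicit Arguments.
Unset Strict Implicit.
Unset Printing Implicit Defensive.
Import Order.TTheory GRing.Theory Num.Theory.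
Import numFieldNormedType.Exports.
Local Open Scope ring_scope.

(* Write p = r - 1 and call c(uv) = a + 1 - w(uv) the cost of a pair. In T the
   cost of s vertices is at least kappa = p C(d+1, 2) + d + 1, and the optimal
   weights equalise all the logarithmic degrees; so it suffices to show that a
   graph on N vertices in which every s-set costs at least kappa has a vertex
   whose logarithmic cost degree is at least that of T (up to a constant), and
   to delete vertices one by one.

   Since phi(c) = ln (a + 1) - ln (a + 1 - c) satisfies phi(c) >= phi(1) c, and
   phi(c) >= phi(d + 1) c / (d + 1) for c > d, only two slopes matter; their
   ratio g satisfies g (d + 1) < d + 2, which is what a > d^2 + d gives.

   If all degrees are smaller than claimed, averaging extends every j-list by a
   vertex of marginal cost at most (j - 1) / p, and these marginals add up to
   exactly kappa. Hence lists of minimal cost mu j extend to lists of minimal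
   cost, all costs are nonnegative, and every vertex costs at least d + 1 to a
   minimal list of n = s - 1 vertices, with small total excess. Around such a
   list one finds p disjoint classes of nearly maximal size whose inner pairs
   cost at least 1, and then a minimal n-list shaped as in T: a vertex z and
   d + 1 vertices in each class. Comparing the degrees of its vertices, with
   weight g on the classes and 1 on z, gives the contradiction. *)

(** * Costs of lists of vertices *)

Definition marg (V : Type) (c : V -> V -> int) (l : seq V) (v : V) : int :=
  \sum_(w <- l) c w v.

(** Lists may repeat a vertex, a repetition paying the diagonal value [c v v]. Averaging over all
    vertices then never has to exclude those already listed. *)
Fixpoint cost (V : Type) (c : V -> V -> int) (l : seq V) : int :=
  if l is v :: l' then marg c l' v + cost c l' else 0.

(** The cost of one free vertex and j - 1 vertices spread as evenly as possible over p classes, when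
    pairs inside a class cost 1 and all others 0. *)
Definition mu (p j : nat) : nat := (\sum_(0 <= i < j.-1) i %/ p)%N.

Lemma muS p j : mu p j.+2 = (mu p j.+1 + j %/ p)%N.
Proof. by rewrite /mu /= big_nat_recr. Qed.

Lemma muE p t i : (0 < p)%N -> (i <= p)%N ->
  mu p (p * t + i).+1 = (p * 'C(t, 2) + i * t)%N.
Proof.
move=> p0; elim: t i => [|t IHt] i; elim: i => [|i IHi] ip.
- by rewrite /mu muln0 /= big_geq// bin0n muln0.
- rewrite addnS muS IHi; last exact: ltnW.
  have -> : (p * 0 + i = i)%N by lia.
  by rewrite divn_small//; lia.
- by rewrite addn0 mulnS addnC IHt// binS bin1; lia.
- rewrite addnS muS IHi; last exact: ltnW.
  by rewrite [(p * t.+1 + i)%N]addnC [(p * t.+1)%N]mulnC divnDMl// divn_small//; lia.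
Qed.

Section Cost.
Variables (V : finType) (c : V -> V -> int).
Hypothesis csym : forall u v, c u v = c v u.

Lemma marg_cons w l v : marg c (w :: l) v = c w v + marg c l v.
Proof. by rewrite /marg big_cons. Qed.

Lemma marg_cat l1 l2 v : marg c (l1 ++ l2) v = marg c l1 v + marg c l2 v.
Proof. by rewrite /marg big_cat. Qed.

Lemma marg_perm l1 l2 v : perm_eq l1 l2 -> marg c l1 v = marg c l2 v.
Proof. by move=> e; apply: perm_big. Qed.

(** The right-hand side does not depend on the order of the list, whence [cost_perm]. *)
Lemma cost_double l : cost c l + cost c l =
  \sum_(u <- l) \sum_(v <- l) c u v - \sum_(u <- l) c u u.
Proof.
elim: l => [|x l IHl] /=; first by rewrite !big_nil.
have -> : \sum_(u <- x :: l) \sum_(v <- x :: l) c u v =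
    c x x + marg c l x + (marg c l x + \sum_(u <- l) \sum_(v <- l) c u v).
  rewrite !big_cons /marg -big_split /=; congr (_ + _ + _).
    by apply: eq_bigr => u _.
  by apply: eq_bigr => u _; rewrite big_cons.
rewrite big_cons addrACA IHl.
move: (\sum_(u <- l) \sum_(v <- l) c u v) => A.
move: (\sum_(u <- l) c u u) (marg c l x) (c x x) => B C D.
lia.
Qed.

Lemma cost_perm l1 l2 : perm_eq l1 l2 -> cost c l1 = cost c l2.
Proof.
move=> e; suff : cost c l1 + cost c l1 = cost c l2 + cost c l2 by lia.
rewrite !cost_double !(perm_big _ e); congr (_ - _).
by apply: eq_bigr => u _; apply: perm_big.
Qed.

Lemma cost_cat l1 l2 :
  cost c (l1 ++ l2) = cost c l1 + cost c l2 + \sum_(v <- l1) marg c l2 v.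
Proof.
elim: l1 => [|x l IHl] /=; first by rewrite big_nil; lia.
rewrite IHl marg_cat big_cons.
by move: (\sum_(v <- l) marg c l2 v) => A; lia.
Qed.

End Cost.

Section Tot.
Variable V : finType.
Implicit Types f g : V -> int.

Definition tot f : int := \sum_v f v.

Lemma eq_tot f g : f =1 g -> tot f = tot g.
Proof. by move=> fg; apply: eq_bigr => v _. Qed.

Lemma totD f g : tot (fun v => f v + g v) = tot f + tot g.
Proof. exact: big_split. Qed.

Lemma totN f : tot (fun v => - f v) = - tot f.
Proof. exact: sumrN. Qed.

Lemma totZ (k : int) f : tot (fun v => k * f v) = k * tot f.
Proof. by rewrite /tot mulr_sumr. Qed.

Lemma tot_const (k : int) : tot (fun=> k) = k * #|V|%:Z.
Proof. by rewrite /tot sumr_const -mulr_natr natz. Qed.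

Lemma tot_le f g : (forall v, f v <= g v) -> tot f <= tot g.
Proof. by move=> fg; apply: ler_sum => v _. Qed.

Lemma tot_sum (I : finType) (P : pred I) (F : I -> V -> int) :
  tot (fun v => \sum_(i | P i) F i v) = \sum_(i | P i) tot (F i).
Proof. by rewrite /tot exchange_big. Qed.

End Tot.

Lemma sumr_uniq_bool (I : finType) (P Q : pred I) (i : I) :
  (forall j, Q j = (j == i)) -> \sum_(j | P j) (Q j : nat)%:Z = (P i : nat)%:Z.
Proof.
move=> QE; rewrite big_mkcond (bigD1 i) //= QE eqxx big1 ?addr0; last first.
  by move=> j ji; rewrite QE (negbTE ji); case: ifP.
by case: (P i).
Qed.

(** * The optimal configuration *)

Section Core.
Variables (V : finType) (c : V -> V -> int) (p d : nat) (L : int).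
Local Notation s := (p * d.+1).+2.
Local Notation N := (#|V|%:Z).
Local Notation M := (marg c).
Hypothesis csym : forall u v, c u v = c v u.
Hypothesis p_gt0 : (0 < p)%N.
Hypothesis V_gt0 : (0 < #|V|)%N.
Hypothesis cost_s : forall l, size l = s -> (mu p s)%:Z <= cost c l.
Hypothesis degL : forall v, tot (c v) <= L.
Hypothesis L_small : L * (p * d.+2 + 1)%:Z < d.+2%:Z * N.

(* What p disjoint sets of size L leave uncovered; a set whose inner pairs cost
   at least 1 has size at most L. *)
Let zeta : int := N - p%:Z * L.

Lemma L_lt_zeta : L < d.+2%:Z * zeta.
Proof. by rewrite /zeta; move: L_small; nia. Qed.

Lemma zeta_gt0 : 0 < zeta.
Proof.
have := L_lt_zeta; rewrite /zeta.
have [L0|L0] := leP 0 L; first by nia.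
by move: p_gt0 V_gt0; nia.
Qed.

Lemma tot_marg l : tot (M l) <= (size l)%:Z * L.
Proof.
elim: l => [|x l IHl].
  by rewrite /tot big1 ?mul0r// => v _; rewrite /marg big_nil.
rewrite (eq_tot (g := fun v => c x v + M l v)); last exact: marg_cons.
by rewrite totD; have := degL x; move: IHl => /=; lia.
Qed.

(** With F the bound, [size l] is at most p (F + 1). If all marginals were at least F + 1, comparing
    their total with [tot_marg] would give N <= p L, against [zeta_gt0]. *)
Lemma exists_marg_le l : (0 < size l)%N ->
  exists v, M l v <= ((size l).-1 %/ p)%:Z.
Proof.
move=> l0; set F := ((size l).-1 %/ p)%N.
have [/existsP[v vP]|] := boolP [exists v, M l v <= F%:Z]; first by exists v.
rewrite negb_exists => /forallP nM; exfalso.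
have : tot (fun _ : V => F%:Z + 1) <= tot (M l).
  by apply: tot_le => v; have := nM v; rewrite -ltNge; lia.
rewrite tot_const => h1; have h2 := tot_marg l.
have pF : (size l <= p * F.+1)%N.
  by have := ltn_ceil (size l).-1 p_gt0; rewrite -/F; lia.
have := zeta_gt0; rewrite /zeta => z0.
have : (size l)%:Z * N <= (size l)%:Z * (p%:Z * L).
  apply: (@le_trans _ _ ((p%:Z * (F%:Z + 1)) * N)); last by nia.
  by rewrite ler_wpM2r; lia.
by nia.
Qed.

(** Backward induction from s: the marginals offered by [exists_marg_le] are at most the increments
    of [mu], so a list that is too cheap would grow into an s-list violating [cost_s]. *)
Lemma mu_le_cost l : (0 < size l <= s)%N -> (mu p (size l))%:Z <= cost c l.
Proof.
move=> /andP[l0 ls].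
have [k kE] : exists k, (k + size l = s)%N by exists (s - size l)%N; lia.
elim: k l l0 ls kE => [|k IHk] l l0 ls kE.
  by rewrite -[X in mu p X]add0n kE; apply: cost_s; rewrite -kE.
have [v vM] := exists_marg_le l0.
have /= := IHk (v :: l) isT _ _.
have -> : mu p (size l).+1 = (mu p (size l) + (size l).-1 %/ p)%N.
  by case: (size l) l0 => // m _; rewrite muS.
by move=> h; have := h ltac:(lia) ltac:(lia); lia.
Qed.

Definition opt l := cost c l = (mu p (size l))%:Z.

Lemma mu_size (l : seq V) : (0 < size l)%N ->
  mu p (size l).+1 = (mu p (size l) + (size l).-1 %/ p)%N.
Proof. by case: (size l) => // m _; rewrite muS. Qed.

Lemma opt_marg l v : opt l -> (0 < size l < s)%N ->
  ((size l).-1 %/ p)%:Z <= M l v.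
Proof.
move=> lo /andP[l0 ls]; have := @mu_le_cost (v :: l).
by rewrite /= mu_size// lo => /(_ ltac:(lia)); lia.
Qed.

Lemma opt_ext l : opt l -> (0 < size l < s)%N ->
  exists2 v, M l v = ((size l).-1 %/ p)%:Z & opt (v :: l).
Proof.
move=> lo ls; have /andP[l0 _] := ls.
have [v vM] := exists_marg_le l0; have vM' := opt_marg v lo ls.
have vE : M l v = ((size l).-1 %/ p)%:Z by lia.
by exists v => //; rewrite /opt /= mu_size// lo vE; lia.
Qed.

Lemma exists_opt j : (0 < j <= s)%N -> exists2 l, size l = j & opt l.
Proof.
elim: j => [//|[|j] IHj] js.
  have /card_gt0P[v _] := V_gt0.
  by exists [:: v] => //; rewrite /opt /= /marg big_nil /mu big_nil.
have [l lj lo] := IHj ltac:(lia).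
have [v _ vo] := @opt_ext l lo ltac:(lia).
by exists (v :: l) => //=; rewrite lj.
Qed.

(** A list of two entries costs at least [mu p 2], which is 0; the case u = v is included. *)
Lemma c_ge0 u v : 0 <= c u v.
Proof.
have := @mu_le_cost [:: u; v]; rewrite /= /marg big_nil big_seq1 csym => /(_ ltac:(lia)).
by rewrite /mu /= big_nat1 div0n; lia.
Qed.

Lemma marg_ge0 l v : 0 <= M l v.
Proof. by apply: sumr_ge0 => w _; exact: c_ge0. Qed.

Lemma cost_pairwise0 l : pairwise (fun u v => c u v == 0) l -> cost c l = 0.
Proof.
elim: l => //= x l IHl /andP[/allP xl /IHl ->].
by rewrite addr0 /marg big_seq big1// => w /xl /eqP; rewrite csym.
Qed.

Definition tmarg (Q : pred 'I_p) (T : 'I_p -> V) (v : V) : int :=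
  \sum_(l | Q l) c (T l) v.

Lemma tmarg_ge0 Q T v : 0 <= tmarg Q T v.
Proof. by apply: sumr_ge0 => w _; exact: c_ge0. Qed.

Lemma tmarg_D1 (Q : pred 'I_p) T v l : Q l ->
  tmarg Q T v = c (T l) v + tmarg (fun l' => Q l' && (l' != l)) T v.
Proof. by move=> Ql; rewrite /tmarg (bigD1 l). Qed.

Lemma tot_tmarg (Q : pred 'I_p) T : tot (tmarg Q T) <= #|Q|%:Z * L.
Proof.
rewrite /tmarg tot_sum.
apply: (@le_trans _ _ (\sum_(i | Q i) L)); first by apply: ler_sum => i _.
by rewrite sumr_const -mulr_natr natz mulrC.
Qed.

(** * Tight vertices around a minimal list of p d + 1 vertices *)

Section Base.
Variable S : seq V.
Hypothesis S_opt : opt S.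
Hypothesis S_size : size S = (p * d).+1.

Lemma marg_S_ge v : d%:Z <= M S v.
Proof.
have := @opt_marg S v S_opt; rewrite S_size /= mulKn//.
by apply; rewrite mulnS; lia.
Qed.

Definition tight (v : V) := M S v == d%:Z.

(** Such tuples are what extends S to a minimal list of s - 1 vertices ([ztup_opt]), all of whose
    marginals are then at least d + 1. *)
Definition ztup (T : 'I_p -> V) :=
  (forall l, tight (T l)) /\ (forall l l', l != l' -> c (T l) (T l') = 0).

Definition tuple_seq (T : 'I_p -> V) := [seq T l | l <- enum 'I_p].

Lemma marg_tuple_seq T v : M (tuple_seq T) v = tmarg xpredT T v.
Proof. by rewrite /marg /tmarg big_map big_enum. Qed.

Lemma ztup_opt T : ztup T -> opt (tuple_seq T ++ S).
Proof.
move=> [TW T0]; rewrite /opt cost_cat cost_pairwise0; last first.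
  rewrite /tuple_seq pairwise_map; apply: (@sub_pairwise _ [rel x y | x != y]).
    by move=> l l' /= ll'; apply/eqP/T0.
  by rewrite -uniq_pairwise enum_uniq.
rewrite S_opt size_cat size_map size_enum_ord S_size.
rewrite (_ : \sum_(v <- _) _ = (p * d)%:Z); last first.
  rewrite big_map big_enum (eq_bigr (fun=> d%:Z)); last by move=> l _; apply/eqP/TW.
  by rewrite sumr_const card_ord -mulr_natr natz; lia.
have := @muE p d p p_gt0 (leqnn p); have := @muE p d 0 p_gt0 (leq0n p).
rewrite addn0 mul0n addn0 => ->.
have -> : (p + (p * d).+1 = (p * d + p).+1)%N by lia.
by move=> ->; rewrite PoszD; lia.
Qed.

Lemma ztup_marg T v : ztup T -> d%:Z + 1 <= M S v + tmarg xpredT T v.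
Proof.
move=> Tz; have := opt_marg v (ztup_opt Tz).
rewrite marg_cat marg_tuple_seq size_cat size_map size_enum_ord S_size.
have -> : ((p + (p * d).+1).-1 %/ p = d.+1)%N.
  by rewrite addnS /= mulnC addnC -mulSnr mulnK.
move=> /(_ _)/wrap[]; first by lia.
by move: (tmarg xpredT T v) (M S v) => A B; lia.
Qed.

(** Extend S minimally p times. Each new vertex has marginal exactly d, and S alone accounts for at
    least d, so nothing is left for the vertices added before. *)
Lemma exists_ztup : exists y, ztup y.
Proof.
have [T [Ts TW Tz _]] : exists T, [/\ size T = p, all tight T,
    pairwise (fun u v => c u v == 0) T & opt (T ++ S)].
  have : (p <= p)%N by [].
  elim: {1 3}p => [|i IHi] ip; first by exists [::].
  have [T [Ts TW Tz To]] := IHi (ltnW ip).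
  have [v vM vo] := @opt_ext _ To ltac:(rewrite size_cat Ts S_size mulnS; lia).
  move: vM; rewrite size_cat Ts S_size addnS /= addnC mulnC divnMDl// divn_small//.
  rewrite addn0 marg_cat => vM.
  have := marg_S_ge v; have := marg_ge0 T v => h1 h2.
  exists (v :: T); split => //=.
  - by rewrite Ts.
  - rewrite TW andbT /tight; lia.
  rewrite Tz andbT; apply/allP => w wT.
  have : M T v = 0 by lia.
  rewrite /marg => /eqP; rewrite big_seq psumr_eq0.
    by move=> /allP /(_ w wT); rewrite wT /= csym.
  by move=> ? _; exact: c_ge0.
have /card_gt0P[x0 _] := V_gt0.
exists (fun l => nth x0 T l); split.
  by move=> l; apply: (allP TW); rewrite mem_nth// Ts.
have TP : forall l l' : 'I_p, (l < l')%N -> c (nth x0 T l) (nth x0 T l') = 0.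
  move=> l l' ll'; apply/eqP; have /(pairwiseP x0) := Tz.
  by apply => //; rewrite inE Ts.
move=> l l' nll'; have [ll'|l'l|/ord_inj ll'] := ltngtP l l'; first exact: TP.
  by rewrite csym; exact: TP.
by rewrite ll' eqxx in nll'.
Qed.

(** * The p classes around a zero-cost tuple *)

Section Classes.
Variable y : 'I_p -> V.
Hypothesis yz : ztup y.

Definition cls (l : 'I_p) (v : V) :=
  tight v && [forall l', (l' != l) ==> (c (y l') v == 0)].

Lemma clsP l v :
  reflect (M S v = d%:Z /\ forall l', l' != l -> c (y l') v = 0) (cls l v).
Proof.
apply: (iffP andP) => -[/eqP vW h]; split => //.
  by move=> l' ll'; apply/eqP; move/forallP: h => /(_ l') /implyP; apply.
by apply/forallP => l'; apply/implyP => /h ->.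
Qed.

Lemma cls_tight l v : cls l v -> tight v. Proof. by case/andP. Qed.

Lemma cls_tmarg l v : cls l v -> tmarg xpredT y v = c (y l) v.
Proof.
move=> /clsP[_ h]; rewrite (@tmarg_D1 _ _ _ l)// [X in _ + X]/tmarg big1 ?addr0//.
Qed.

Lemma cls_y l : cls l (y l).
Proof.
case: yz => yW y0; apply/clsP; split; first exact: (eqP (yW l)).
by move=> l' ll'; apply: y0.
Qed.

(** Replacing [y l] by u gives another zero-cost tuple; its marginal at v together with that of S is
    d + c u v and must reach d + 1. Taking u = v bounds the diagonal as well. *)
Lemma cls_clique l u v : cls l u -> cls l v -> 1 <= c u v.
Proof.
move=> /clsP[uW u0] /clsP[vW v0]; case: yz => yW y0.
pose T l' := if l' == l then u else y l'.
have Tz : ztup T.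
  split; first by move=> l'; rewrite /T; case: eqP => // _; apply/eqP.
  move=> l1 l2; rewrite /T.
  case: (eqVneq l1 l) => [e1|n1]; case: (eqVneq l2 l) => [e2|n2] ll'.
  - by rewrite e1 e2 eqxx in ll'.
  - by rewrite csym u0.
  - by rewrite u0.
  - exact: y0.
have tmE : tmarg xpredT T v = c u v.
  rewrite (@tmarg_D1 _ _ _ l)// [X in _ + X]/tmarg big1 /T ?eqxx ?addr0//.
  by move=> l' /= l'l; rewrite (negbTE l'l) v0.
by have := ztup_marg v Tz; rewrite tmE vW; lia.
Qed.

Lemma cls_inj l l' v : cls l v -> cls l' v -> l = l'.
Proof.
move=> Pl Pl'; apply/eqP/negPn/negP => ll'.
have := ztup_marg v yz; rewrite (cls_tmarg Pl).
by move/clsP: Pl' => [-> h]; rewrite (h _ ll'); lia.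
Qed.

Definition mixed v := tight v && [forall l, ~~ cls l v].

Definition cls_sum (Q : pred 'I_p) (v : V) : int := \sum_(l | Q l) (cls l v : nat)%:Z.

Variant cls_sum_spec v : (pred 'I_p -> int) -> bool -> bool -> Prop :=
| ClsSumIn l0 of cls l0 v : cls_sum_spec v (fun Q => (Q l0 : nat)%:Z) true false
| ClsSumMixed of (forall l, ~~ cls l v) & tight v & (2 <= tmarg xpredT y v) :
    cls_sum_spec v (fun=> 0) true true
| ClsSumLoose of (forall l, ~~ cls l v) & (d%:Z + 1 <= M S v) :
    cls_sum_spec v (fun=> 0) false false.

(** The case analysis behind the counting arguments: a vertex is in exactly one class, mixed, or
    loose. A mixed vertex has positive cost to some [y l] because its marginal must reach d + 1, and
    to a second one because it is not in class l. *)
Lemma cls_sumP v : exists2 f, cls_sum^~ v =1 f & cls_sum_spec v f (tight v) (mixed v).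
Proof.
have [/existsP[l0 Pl0]|] := boolP [exists l, cls l v].
  exists (fun Q => (Q l0 : nat)%:Z).
    move=> Q; apply: sumr_uniq_bool => j.
    by apply/idP/eqP => [/cls_inj/(_ Pl0)|->].
  rewrite (cls_tight Pl0) (_ : mixed v = false); first exact: ClsSumIn.
  by rewrite /mixed; apply/negP => /andP[_ /forallP/(_ l0)]; rewrite Pl0.
rewrite negb_exists => /forallP nP.
exists (fun=> 0).
  by move=> Q; rewrite /cls_sum big1// => l _; rewrite (negbTE (nP l)).
have -> : mixed v = tight v by rewrite /mixed (introT forallP nP) andbT.
have := ztup_marg v yz; have := marg_S_ge v; rewrite /tight.
case: eqP => [vW _ h|vW h _]; last by apply: ClsSumLoose => //; move: h vW; lia.
apply: ClsSumMixed => //; first exact/eqP.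
have [l Pl] : exists l, c (y l) v != 0.
  apply/existsP; rewrite -negb_forall; apply/negP => /forallP h0.
  by move: h; rewrite vW /tmarg big1 => [|l _]; [lia|apply/eqP].
have : ~~ cls l v by [].
rewrite /cls /tight vW eqxx /= negb_forall => /existsP[l']; rewrite negb_imply => /andP[ll' Pl'].
rewrite (@tmarg_D1 _ _ _ l)// (@tmarg_D1 _ _ _ l')//.
have := c_ge0 (y l) v; have := c_ge0 (y l') v.
have := tmarg_ge0 (fun l0 => true && (l0 != l) && (l0 != l')) y v.
by move: (tmarg _ _ _) Pl Pl' => A; lia.
Qed.

Definition cnt (Q : pred V) : int := tot (fun v => (Q v : nat)%:Z).

Definition cls_total (Q : pred 'I_p) : int := \sum_(l | Q l) cnt (cls l).

Lemma tot_cls_sum Q : tot (cls_sum Q) = cls_total Q.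
Proof. exact: tot_sum. Qed.

Lemma cnt_tight_ge : d.+1%:Z * N - cnt tight <= (p * d).+1%:Z * L.
Proof.
have := tot_marg S; rewrite S_size; apply: le_trans.
rewrite -tot_const /cnt -totN -totD; apply: tot_le => v.
by have := marg_S_ge v; rewrite /tight; case: eqP; lia.
Qed.

Lemma cnt_tight_eq : cnt tight = cls_total xpredT + cnt mixed.
Proof.
rewrite -tot_cls_sum /cnt -totD; apply: eq_tot => v.
by have [f fE] := cls_sumP v; rewrite fE; case.
Qed.

(** Each tight vertex takes at least 1 from the total degree p L available to T; the rest bounds the
    cost from T to loose vertices. *)
Lemma ztup_loose T : ztup T ->
  tot (fun v => (~~ tight v : nat)%:Z * tmarg xpredT T v) + cnt tight <= p%:Z * L.
Proof.
move=> Tz; have := tot_tmarg xpredT T; rewrite card_ord; apply: le_trans.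
rewrite /cnt -totD; apply: tot_le => v.
have := ztup_marg v Tz; rewrite /tight; case: eqP => [->|] /=; lia.
Qed.

(** The list made of S and y has marginals at least d + 1. Mixed vertices exceed this by at least 1,
    members v of class i by c (y i) v - 1. *)
Lemma excess_cls i :
  d.+1%:Z * N + cnt mixed + tot (fun v => (cls i v : nat)%:Z * (c (y i) v - 1)) <=
  (p * d.+1).+1%:Z * L.
Proof.
have h1 := tot_marg S; have h2 := tot_tmarg xpredT y.
rewrite S_size in h1; rewrite card_ord in h2.
apply: (@le_trans _ _ (tot (M S) + tot (tmarg xpredT y))); last by move: h1 h2; lia.
rewrite -tot_const /cnt -!totD; apply: tot_le => v.
have := ztup_marg v yz; have [f _ fS] := cls_sumP v.
have [Pi|nPi] := boolP (cls i v).
  have nB : mixed v = false.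
    by rewrite /mixed; apply/negP => /andP[_ /forallP/(_ i)]; rewrite Pi.
  by rewrite nB (cls_tmarg Pi); case/clsP: Pi => ->; lia.
by case: fS => [l0 _|_ /eqP -> h|_ h] /=; lia.
Qed.

(** Without [y l], the list made of S and y still has marginals at least d + 1 outside class l, and
    at least d inside, so a small class would exceed the available degree. *)
Lemma cnt_cls_ge l : d.+1%:Z * N - cnt (cls l) <= (p * d.+1)%:Z * L.
Proof.
have h1 := tot_marg S; have h2 := tot_tmarg (fun l' => l' != l) y.
rewrite S_size in h1; rewrite cardC1 card_ord in h2.
apply: (@le_trans _ _ (tot (M S) + tot (tmarg (fun l' => l' != l) y))); last first.
  by move: h1 h2 p_gt0; rewrite mulnS; move: (tot _) (tot _) => A B; nia.
rewrite -tot_const /cnt -totN -!totD; apply: tot_le => v.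
have := marg_S_ge v; have := tmarg_ge0 (fun l' => l' != l) y v.
have [Pi|nPi] := boolP (cls l v); first by lia.
have [vW|] := eqVneq (M S v) d%:Z; last by lia.
suff : tmarg (fun l' => l' != l) y v != 0 by move: (tmarg _ _ _) => A; rewrite vW; lia.
apply: contra nPi => /eqP h; apply/clsP; split => // l' ll'.
move/eqP: h; rewrite /tmarg psumr_eq0; last by move=> *; exact: c_ge0.
by move=> /allP/(_ l'); rewrite mem_index_enum ll' => /(_ isT)/eqP.
Qed.

Lemma cnt_cls_le l : cnt (cls l) <= L.
Proof.
apply: le_trans (degL (y l)); apply: tot_le => v.
by have [/(cls_clique (cls_y l))|_] := boolP (cls l v); have := c_ge0 (y l) v; lia.
Qed.

(* An upper bound for the total excess over d + 1 of the marginals of a list of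
   minimal cost with s - 1 elements. *)
Let e : int := L - d.+1%:Z * zeta.

Lemma e_lt_zeta : e < zeta.
Proof. by rewrite /e; have := L_lt_zeta; lia. Qed.

(** This amounts to L < 2 (d + 1) zeta, and (d + 2) zeta is at most the right-hand side. *)
Lemma e2_lt_L : e + e < L.
Proof.
have : 0 <= d%:Z * zeta by rewrite mulr_ge0// ltW// zeta_gt0.
by rewrite /e; have := L_lt_zeta; have := zeta_gt0; move: zeta => x; lia.
Qed.

Lemma cnt_loose_le : N - cnt tight <= zeta + e.
Proof. by rewrite /e /zeta; have := cnt_tight_ge; lia. Qed.

Lemma excess_le i :
  cnt mixed + tot (fun v => (cls i v : nat)%:Z * (c (y i) v - 1)) <= e.
Proof. by rewrite /e /zeta; have := excess_cls i; lia. Qed.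

Lemma cnt_mixed_le : cnt mixed <= e.
Proof.
have := excess_le (Ordinal p_gt0); set t := tot _.
suff : 0 <= t by lia.
apply: sumr_ge0 => v _; case: (boolP (cls _ v)) => [Pv|_]; last by rewrite mul0r.
by rewrite mul1r subr_ge0 (cls_clique (cls_y _) Pv).
Qed.

Lemma cnt_cls_geL l : L - e <= cnt (cls l).
Proof. by rewrite /e /zeta; have := cnt_cls_ge l; lia. Qed.

(** The subtracted amount, e + cnt mixed, bounds the joint shortfall of all p classes from L. Each
    shortfall is nonnegative, so the same bound serves every subfamily. *)
Lemma cls_total_ge (Q : pred 'I_p) : #|Q|%:Z * L - (zeta + e + cnt mixed - zeta) <= cls_total Q.
Proof.
have h : \sum_(l | Q l) (L - cnt (cls l)) <= \sum_l (L - cnt (cls l)).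
  rewrite [leRHS](bigID Q) /= lerDl sumr_ge0// => l _.
  by rewrite subr_ge0 cnt_cls_le.
have E (Q' : pred 'I_p) : \sum_(l | Q' l) (L - cnt (cls l)) = #|Q'|%:Z * L - cls_total Q'.
  by rewrite big_split /= sumrN sumr_const -mulr_natr natz mulrC.
move: h; rewrite E (E xpredT) card_ord.
have := cnt_tight_eq; have := cnt_loose_le; rewrite /zeta.
by move: (cls_total Q) (cls_total _) => A B; lia.
Qed.

(** Otherwise [ztup_loose] for y and for T gives N - cnt tight <= 2 (p L - cnt tight), that is 2
    zeta <= N - cnt tight, while the latter is at most zeta + e < 2 zeta. *)
Lemma exists_z T : ztup T ->
  exists z, tmarg xpredT y z = 0 /\ tmarg xpredT T z = 0.
Proof.
move=> Tz.
have [/existsP[z /andP[/eqP z1 /eqP z2]]|] :=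
  boolP [exists z, (tmarg xpredT y z == 0) && (tmarg xpredT T z == 0)]; first by exists z.
rewrite negb_exists => /forallP nz; exfalso.
have h1 := ztup_loose yz; have h2 := ztup_loose Tz.
have : N - cnt tight <= tot (fun v => (~~ tight v : nat)%:Z * tmarg xpredT y v) +
    tot (fun v => (~~ tight v : nat)%:Z * tmarg xpredT T v).
  rewrite -[N]mul1r -tot_const /cnt -totN -!totD; apply: tot_le => v.
  have := nz v; have := tmarg_ge0 xpredT y v; have := tmarg_ge0 xpredT T v.
  by move: (tmarg _ _ _) (tmarg _ _ _) => A B; case: (tight v) => /=; lia.
have := cnt_loose_le; have := e_lt_zeta; rewrite /zeta.
by move: h1 h2; move: (tot _) (tot _) => A B; lia.
Qed.

(** Greedy choice, class by class. If class i offers no vertex, each member has excess cost to [y i]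
    or positive cost to an earlier b. The earlier b spend most of their degree on their own classes,
    and the joint shortfall of the classes up to i then forces L <= 2 e. *)
Lemma exists_second : exists b, [/\ forall l, cls l (b l),
  forall l, c (y l) (b l) = 1 & forall l l', l != l' -> c (b l) (b l') = 0].
Proof.
suff /(_ p (leqnn p))[b bP] : forall i, (i <= p)%N ->
    exists b, forall l : 'I_p, (l < i)%N -> [/\ cls l (b l), c (y l) (b l) = 1 &
      forall l' : 'I_p, (l' < l)%N -> c (b l') (b l) = 0].
  have bP' l : [/\ cls l (b l), c (y l) (b l) = 1 &
    forall l' : 'I_p, (l' < l)%N -> c (b l') (b l) = 0] by apply: bP.
  exists b; split; [by move=> l; case: (bP' l)|by move=> l; case: (bP' l)|].
  move=> l l' nll'; have [ll'|l'l|/ord_inj ll'] := ltngtP l l'.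
  - by case: (bP' l') => _ _; apply.
  - by rewrite csym; case: (bP' l) => _ _; apply.
  - by rewrite ll' eqxx in nll'.
elim=> [|i IHi] ip; first by exists y.
have [b bP] := IHi (ltnW ip); pose io := Ordinal ip.
pose Q := [pred l : 'I_p | (l < i)%N].
suff [v [Pv yv bv]] : exists v, [/\ cls io v, c (y io) v = 1 & tmarg Q b v = 0].
  exists (fun l => if l == io then v else b l) => l li.
  have [->|nl] := eqVneq l io.
    split=> // l' l'i; rewrite (_ : (l' == io) = false); last first.
      by apply/negP => /eqP l'E; rewrite l'E ltnn in l'i.
    move/eqP: bv; rewrite /tmarg psumr_eq0; last by move=> *; exact: c_ge0.
    by move=> /allP/(_ l'); rewrite mem_index_enum => /(_ isT)/implyP/(_ l'i)/eqP.
  have li' : (l < i)%N.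
    by rewrite ltnNge; apply: contra nl => il; apply/eqP/ord_inj => /=; lia.
  have [h1 h2 h3] := bP l li'; split => // l' l'l.
  rewrite (_ : (l' == io) = false) ?h3//.
  by apply/negP => /eqP l'E; move: l'l; rewrite l'E /=; lia.
have [/existsP[v /and3P[v1 /eqP v2 /eqP v3]]|] :=
  boolP [exists v, [&& cls io v, c (y io) v == 1 & tmarg Q b v == 0]]; first by exists v.
rewrite negb_exists => /forallP nv; exfalso.
have h1 : cnt (cls io) <= tot (fun v => (cls io v : nat)%:Z * (c (y io) v - 1)) +
    tot (fun v => (cls io v : nat)%:Z * tmarg Q b v).
  rewrite /cnt -totD; apply: tot_le => v.
  have := nv v; have := tmarg_ge0 Q b v; move: (tmarg _ _ _) => A.
  have [Pv|_] := boolP (cls io v); last by lia.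
  by have := cls_clique (cls_y io) Pv; lia.
have h2 : tot (fun v => (cls io v : nat)%:Z * tmarg Q b v) + cls_total Q <= #|Q|%:Z * L.
  apply: le_trans (tot_tmarg Q b).
  rewrite -tot_cls_sum -totD; apply: tot_le => v; rewrite /cls_sum /tmarg mulr_sumr -big_split /=.
  apply: ler_sum => l li; have [h _ _] := bP l li.
  have := c_ge0 (b l) v; have [Pv|nPv] := boolP (cls l v).
    have := cls_clique h Pv.
    have [Pi|_] := boolP (cls io v); last by lia.
    by have lE := cls_inj Pv Pi; move: li; rewrite lE /= ltnn.
  by case: (cls io v); lia.
have h3 := excess_le io; have h4 := cls_total_ge Q.
have h5 : cls_total (fun l => Q l || (l == io)) = cls_total Q + cnt (cls io).
  rewrite {1}/cls_total (bigD1 io) /=; last by rewrite eqxx orbT.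
  rewrite addrC; congr (_ + cnt (cls io)); apply: eq_bigl => j.
  by rewrite -val_eqE /=; case: ltngtP.
have := cls_total_ge (fun l => Q l || (l == io)).
have -> : #|(fun l => Q l || (l == io))| = #|Q|.+1.
  rewrite (cardD1 io) unfold_in eqxx orbT add1n; congr _.+1.
  by apply: eq_card => j; rewrite !inE /= /in_mem /= -val_eqE /=; case: ltngtP.
rewrite h5; have := e2_lt_L.
by move: h1 h2 h3; move: (tot _) (tot _) => A B; lia.
Qed.

(** * Growing a minimal list shaped as in the pattern *)

Definition parts (A : 'I_p -> seq V) := flatten [seq A l | l <- enum 'I_p].

Lemma marg_parts A v : M (parts A) v = \sum_l M (A l) v.
Proof. by rewrite /marg big_flatten big_map big_enum. Qed.

Lemma marg_parts_D1 A i v :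
  M (parts A) v = M (A i) v + \sum_(l < p | l != i) M (A l) v.
Proof. by rewrite marg_parts (bigD1 i). Qed.

Lemma size_parts A : size (parts A) = (\sum_l size (A l))%N.
Proof. by rewrite size_flatten /shape sumnE -map_comp big_map big_enum. Qed.

Definition add_part (A : 'I_p -> seq V) i v l := if l == i then v :: A i else A l.

Lemma perm_add_part A i v : perm_eq (parts (add_part A i v)) (v :: parts A).
Proof.
have countE B a : count a (parts B) = (\sum_l count a (B l))%N.
  by rewrite count_flatten sumnE -map_comp big_map big_enum.
apply/permP => a /=; rewrite !countE.
rewrite (bigD1 i)//= [in RHS](bigD1 i)//= /add_part eqxx /= addnA; congr (_ + _)%N.
by apply: eq_bigr => l /negbTE ->.
Qed.

Section Config.
Variable z : V.

(** The second clause says that, besides the diagonal cost [c x x] due to x being in the list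
    itself, x pays the least possible amount: 1 per other entry of its part. *)
Definition config A := [/\ (forall l x, x \in A l -> cls l x),
  (forall l x, x \in A l -> M (z :: parts A) x = c x x + (size (A l))%:Z - 1),
  (forall l l' x x', l != l' -> x \in A l -> x' \in A l' -> c x x' = 0) &
  opt (z :: parts A)].

Lemma marg_class A i v : config A -> cls i v -> (size (A i))%:Z <= M (A i) v.
Proof.
move=> [AP _ _ _] Pv; rewrite /marg -[leLHS]natz -sum1_size natr_sum.
rewrite big_seq [leRHS]big_seq; apply: ler_sum => x xA.
exact: cls_clique (AP _ _ xA) Pv.
Qed.

(** Part i contributes at least 1 per entry and everything else at least 0, so equality of the sum
    forces equality in every term. *)
Lemma marg_tight A i v : config A -> cls i v ->
  M (z :: parts A) v = (size (A i))%:Z ->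
  [/\ c z v = 0, forall x, x \in A i -> c x v = 1 &
      forall l x, l != i -> x \in A l -> c x v = 0].
Proof.
move=> Ac Pv; rewrite marg_cons (marg_parts_D1 A i) => h.
set X : int := \sum_(l < p | l != i) M (A l) v in h.
have h1 := marg_class Ac Pv; have h2 := c_ge0 z v.
have h3 : 0 <= X by apply: sumr_ge0 => l _; exact: marg_ge0.
have e1 : M (A i) v = (size (A i))%:Z by lia.
have e2 : X = 0 by lia.
split; first by lia.
  have : \sum_(x <- A i) (c x v - 1) = 0.
    rewrite big_split /= sumrN -/(marg c (A i) v) e1.
    by rewrite -[X in X - _]natz -sum1_size natr_sum subrr.
  move/eqP; rewrite big_seq psumr_eq0; last first.
    move=> x xA; rewrite subr_ge0; case: Ac => AP _ _ _.
    exact: cls_clique (AP _ _ xA) Pv.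
  by move=> /allP h4 x xA; have := h4 x xA; rewrite xA /= => /eqP; lia.
move=> l x li xA; move/eqP: e2; rewrite /X psumr_eq0; last by move=> *; exact: marg_ge0.
move=> /allP/(_ l); rewrite mem_index_enum li => /(_ isT); rewrite /= /marg.
rewrite big_seq psumr_eq0; last by move=> *; exact: c_ge0.
by move=> /allP/(_ x xA); rewrite xA => /eqP.
Qed.

(** The condition on the size of part i makes the marginal of v equal to the increment of [mu],
    which preserves minimality. *)
Lemma config_add A i v : config A -> cls i v ->
  M (z :: parts A) v = (size (A i))%:Z ->
  size (A i) = (size (parts A) %/ p)%N -> config (add_part A i v).
Proof.
move=> Ac Pv vM sE; have [zv c1 c0] := marg_tight Ac Pv vM.
have [AP AM A0 Ao] := Ac.
have margE x : M (z :: parts (add_part A i v)) x = c v x + M (z :: parts A) x.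
  by rewrite !marg_cons (marg_perm _ _ (perm_add_part A i v)) marg_cons; lia.
split.
- move=> l x; rewrite /add_part; case: eqVneq => [->|_]; last exact: AP.
  by rewrite inE => /orP[/eqP->|/AP].
- move=> l x; rewrite margE /add_part; case: (eqVneq l i) => [_|li] /=.
    rewrite inE => /orP[/eqP->|xA].
      by rewrite vM; move: (size (A i)) => k; rewrite -addrA; congr (_ + _); lia.
    by rewrite (AM _ _ xA) csym (c1 _ xA); move: (c x x) (size _) => u k; lia.
  by move=> xA; rewrite (AM _ _ xA) csym (c0 _ _ li xA) add0r.
- move=> l l' x x' ll'; rewrite /add_part.
  case: (eqVneq l i) => [li|li]; case: (eqVneq l' i) => [l'i|l'i].
  + by rewrite li l'i eqxx in ll'.
  + rewrite inE => /orP[/eqP->|xA] xA'; first by rewrite csym (c0 l').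
    by apply: (A0 i l') => //; rewrite eq_sym.
  + rewrite inE => xA /orP[/eqP->|xA']; first by rewrite (c0 l).
    by apply: (A0 l i).
  + exact: A0.
have pe : perm_eq (z :: parts (add_part A i v)) (v :: z :: parts A).
  apply/permP => q /=; have /permP/(_ q) /= -> := perm_add_part A i v.
  by rewrite addnCA.
rewrite /opt (cost_perm csym pe) (perm_size pe).
rewrite -[cost c _]/(M (z :: parts A) v + cost c (z :: parts A)) vM Ao /= sE muS.
by rewrite addrC PoszD.
Qed.

Lemma sum_lt_ord i : (i <= p)%N -> (\sum_(l < p) (l < i) = i)%N.
Proof.
move=> ip; rewrite -[RHS](card_ord i) -sum1_card (big_ord_widen p (fun=> 1%N))//.
by rewrite [RHS]big_mkcond; apply: eq_bigr => l _; case: ifP.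
Qed.

Lemma stage_size A t i : (i <= p)%N ->
  (forall l : 'I_p, size (A l) = (t + (l < i))%N) -> size (parts A) = (p * t + i)%N.
Proof.
move=> ip As; rewrite size_parts (eq_bigr (fun l : 'I_p => t + (l < i))%N)//.
by rewrite big_split /= sum_lt_ord// sum_nat_const card_ord.
Qed.

(** Otherwise all members of the classes up to i have marginal at least t + 1, and counting gives t
    zeta <= e + cnt mixed <= 2 e < 2 zeta. As this is absurd only for t >= 2, the round t = 1 is
    done by [config_pairs] from [exists_second] and [exists_z]. *)
Lemma exists_next A t i (ip : (i < p)%N) : config A -> (2 <= t <= d)%N ->
  (forall l : 'I_p, size (A l) = (t + (l < i))%N) ->
  exists2 v, cls (Ordinal ip) v & M (z :: parts A) v = t%:Z.
Proof.
move=> Ac td As; have [_ _ _ Ao] := Ac.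
have Ss := stage_size (ltnW ip) As.
have [/existsP[v /andP[v1 /eqP v2]]|] :=
  boolP [exists v, cls (Ordinal ip) v && (M (z :: parts A) v == t%:Z)]; first by exists v.
rewrite negb_exists => /forallP nv; exfalso.
pose Q := [pred l : 'I_p | (l <= i)%N].
have h1 : t%:Z * N + cls_total Q <= (p * t + i).+1%:Z * L.
  have := tot_marg (z :: parts A); rewrite /= Ss; apply: le_trans.
  rewrite -tot_cls_sum -tot_const -totD; apply: tot_le => v.
  have Mt : t%:Z <= M (z :: parts A) v.
    have := opt_marg v Ao; rewrite /= Ss mulnC divnMDl// divn_small// addn0.
    have ptd : (p * t <= p * d)%N by rewrite leq_mul2l; lia.
    by apply; rewrite mulnC mulnS; lia.
  have [f -> fS] := cls_sumP v; case: fS => [l0 Pl0|_ _ _|_ _] /=; try by rewrite addr0.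
  have [l0i|_] := leqP l0 i; last by rewrite addr0.
  have [l0i'|l0i'] := ltnP l0 i.
    have := marg_class Ac Pl0; rewrite As l0i'.
    rewrite marg_cons (marg_parts_D1 A l0); have := c_ge0 z v.
    set X : int := \sum_(l < p | l != l0) M (A l) v.
    have : 0 <= X by apply: sumr_ge0 => l _; exact: marg_ge0.
    by lia.
  have l0E : l0 = Ordinal ip by apply: ord_inj => /=; lia.
  by have := nv v; rewrite -l0E Pl0 /=; lia.
have h2 := cls_total_ge Q.
have Qc : #|Q| = i.+1.
  rewrite -sum1_card -[RHS](@sum_lt_ord i.+1)// big_mkcond.
  by apply: eq_bigr => l _; rewrite inE ltnS; case: ifP.
rewrite Qc in h2.
have := e_lt_zeta; have := zeta_gt0; have := cnt_mixed_le.
have : 2%:Z * zeta <= t%:Z * zeta.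
  by apply: ler_wpM2r; [exact/ltW/zeta_gt0 | lia].
by move: h1 h2; rewrite /zeta; move: (cls_total Q) e => X Y; lia.
Qed.

Lemma stage t A : config A -> (2 <= t <= d)%N -> (forall l, size (A l) = t) ->
  exists2 A', config A' & forall l, size (A' l) = t.+1.
Proof.
move=> Ac td As.
suff /(_ p (leqnn p))[A' A'c A's] : forall i, (i <= p)%N ->
    exists2 A', config A' & forall l : 'I_p, size (A' l) = (t + (l < i))%N.
  by exists A' => // l; rewrite A's ltn_ord addn1.
elim=> [|i IHi] ip; first by exists A => // l; rewrite As addn0.
have [B Bc Bs] := IHi (ltnW ip).
have [v Pv vM] := exists_next ip Bc td Bs.
have sE : size (B (Ordinal ip)) = t by rewrite Bs ltnn addn0.
exists (add_part B (Ordinal ip) v).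
  apply: config_add; rewrite ?sE// (stage_size (ltnW ip) Bs).
  by rewrite mulnC divnMDl// divn_small// addn0.
by move=> l; rewrite /add_part -val_eqE /=; case: eqP => li /=; rewrite Bs /=; lia.
Qed.

End Config.

Lemma tmarg_eq0 T v l : tmarg xpredT T v = 0 -> c (T l) v = 0.
Proof.
move/eqP; rewrite /tmarg psumr_eq0; last by move=> *; exact: c_ge0.
by move=> /allP/(_ l); rewrite mem_index_enum => /(_ isT)/eqP.
Qed.

Lemma config_singletons z : tmarg xpredT y z = 0 -> config z (fun l => [:: y l]).
Proof.
move=> z0; split.
- by move=> l x; rewrite inE => /eqP ->; exact: cls_y.
- move=> l x; rewrite inE => /eqP ->; rewrite marg_cons (marg_parts_D1 _ l) /marg.
  rewrite big_seq1 csym (tmarg_eq0 l z0) big1 ?addr0 ?addrK ?add0r// => l' ll'.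
  by rewrite big_seq1; case: yz => _; apply.
- by move=> l l' x x' ll'; rewrite !inE => /eqP -> /eqP ->; case: yz => _; apply.
have catE : parts (fun l => [:: y l]) = tuple_seq y by rewrite /parts flatten_map1.
rewrite /opt /= catE marg_tuple_seq z0 add0r size_map size_enum_ord.
rewrite cost_pairwise0.
  have := @muE p 0 p p_gt0 (leqnn p).
  by rewrite muln0 add0n => ->.
rewrite /tuple_seq pairwise_map; apply: (@sub_pairwise _ [rel x y | x != y]).
  by move=> l l' /= ll'; apply/eqP; case: yz => _; apply.
by rewrite -uniq_pairwise enum_uniq.
Qed.

Lemma config_pairs z b : (forall l, cls l (b l)) -> (forall l, c (y l) (b l) = 1) ->
  (forall l l', l != l' -> c (b l) (b l') = 0) ->
  tmarg xpredT y z = 0 -> tmarg xpredT b z = 0 -> forall i, (i <= p)%N ->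
  exists2 A, config z A &
    forall l : 'I_p, A l = if (l < i)%N then [:: b l; y l] else [:: y l].
Proof.
move=> bP yb b0 zy zb; elim=> [|i IHi] ip.
  by exists (fun l => [:: y l]) => //; exact: config_singletons.
have [A Ac AE] := IHi (ltnW ip); pose io := Ordinal ip.
have As l : size (A l) = (1 + (l < i))%N by rewrite AE; case: ifP.
exists (add_part A io (b io)); last first.
  move=> l; rewrite /add_part -val_eqE /=; case: eqP => li.
    have -> : l = io by apply: ord_inj.
    by rewrite AE /= ltnn ltnSn.
  by rewrite AE (_ : (l < i.+1)%N = (l < i)%N)//; lia.
have sio : size (A io) = 1%N by rewrite As /= ltnn.
apply: config_add => //; last first.
  by rewrite sio (stage_size (ltnW ip) As) muln1 addnC divnDr// divnn p_gt0 divn_small.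
rewrite sio marg_cons csym (tmarg_eq0 io zb) (marg_parts_D1 _ io) AE /= ltnn.
rewrite {1}/marg big_seq1 yb big1 ?addr0 ?add0r// => l ll'.
have yl : c (y l) (b io) = 0 by have /clsP[_] := bP io; apply.
rewrite AE /marg; case: ifP => _; first by rewrite big_cons big_seq1 b0// yl.
by rewrite big_seq1.
Qed.

Lemma exists_config : exists z A, config z A /\ forall l, size (A l) = d.+1.
Proof.
have [b [bP yb b0]] := exists_second.
have bz : ztup b by split => // l; exact: cls_tight (bP l).
have [z [zy zb]] := exists_z bz.
suff [A Ac As] : exists2 A, config z A & forall l, size (A l) = d.+1 by exists z, A.
have [d0|d0] := posnP d.
  by exists (fun l => [:: y l]); [exact: config_singletons | rewrite d0].
suff : forall t, (2 <= t <= d.+1)%N -> exists2 A, config z A & forall l, size (A l) = t.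
  by apply; rewrite ltnS d0 leqnn.
elim=> [//|t IHt] td; have [t2|t2] := leqP 2 t.
  by have [A Ac As] := IHt ltac:(lia); apply: stage Ac _ As; lia.
have [A Ac AE] := config_pairs bP yb b0 zy zb (leqnn p).
by exists A => // l; rewrite AE ltn_ord /=; lia.
Qed.

(** * Degrees of the vertices of the final configuration *)

Section Final.
Variables (z : V) (A : 'I_p -> seq V).
Hypothesis Ac : config z A.
Hypothesis As : forall l, size (A l) = d.+1.
Let K := z :: parts A.

Lemma size_K : size K = (p * d.+1).+1.
Proof.
rewrite /= size_parts (eq_bigr (fun=> d.+1))//.
by rewrite sum_nat_const card_ord.
Qed.

Lemma marg_K_ge v : d.+1%:Z <= M K v.
Proof.
have [_ _ _ Ao] := Ac; have := opt_marg v Ao.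
by rewrite size_K /= mulKn//; apply; rewrite ltnS.
Qed.

Lemma mem_K l x : x \in A l -> x \in K.
Proof.
move=> xA; rewrite inE; apply/orP; right; apply/flattenP.
by exists (A l) => //; apply: map_f; rewrite mem_enum.
Qed.

Lemma marg_rem (l : seq V) x w : x \in l -> M l w = c x w + M (rem x l) w.
Proof. by move=> xl; rewrite (marg_perm _ _ (perm_to_rem xl)) marg_cons. Qed.

Lemma cost_rem (l : seq V) x : x \in l -> cost c l = M (rem x l) x + cost c (rem x l).
Proof. by move=> xl; rewrite (cost_perm csym (perm_to_rem xl)). Qed.

Lemma size_rem_K x : x \in K -> size (rem x K) = (p * d.+1)%N.
Proof. by move=> xK; rewrite size_rem// size_K. Qed.

Lemma marg_rem_K l x : x \in A l -> M (rem x K) x = d%:Z.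
Proof.
move=> xA; have [_ AM _ _] := Ac; have := AM l x xA; rewrite As.
by rewrite (marg_rem _ (mem_K xA)); lia.
Qed.

Lemma opt_rem l x : x \in A l -> opt (rem x K).
Proof.
move=> xA; have [_ _ _ Ao] := Ac; have xK := mem_K xA.
have sz := size_rem_K xK.
have : (0 < size (rem x K))%N by rewrite sz muln_gt0 p_gt0.
move=> /mu_size; rewrite sz -size_K => e1.
move: Ao; rewrite /opt -/K e1 (cost_rem xK) (marg_rem_K xA) sz.
have -> : ((p * d.+1).-1 %/ p = d)%N.
  have -> : ((p * d.+1).-1 = d * p + p.-1)%N by rewrite mulnS mulnC; lia.
  by rewrite divnMDl// divn_small ?addn0//; lia.
by lia.
Qed.

Lemma exists_adj l v : 1 <= M (A l) v -> exists2 x, x \in A l & 1 <= c x v.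
Proof.
move=> h; have [/hasP[x xA xv]|/hasPn nh] := boolP (has (fun x => 1 <= c x v) (A l)).
  by exists x.
suff : M (A l) v = 0 by lia.
rewrite /marg big_seq big1// => x xA; have := nh x xA; have := c_ge0 x v; lia.
Qed.

(** Otherwise every member of class l adds to the total excess, so the class has at most e members;
    it has at least L - e > e. *)
Lemma exists_typical l : exists2 a, cls l a & M K a = d.+1%:Z.
Proof.
have [/existsP[v /andP[v1 /eqP v2]]|] :=
  boolP [exists v, cls l v && (M K v == d.+1%:Z)]; first by exists v.
rewrite negb_exists => /forallP nv; exfalso.
have h1 : d.+1%:Z * N + cnt (cls l) <= (p * d.+1).+1%:Z * L.
  have := tot_marg K; rewrite size_K; apply: le_trans.
  rewrite -tot_const /cnt -totD; apply: tot_le => v.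
  by have := nv v; have := marg_K_ge v; case: (cls l v) => /=; lia.
have := cnt_cls_geL l; have := e2_lt_L.
have : cnt (cls l) <= e by move: h1; rewrite /e /zeta; lia.
by lia.
Qed.

Definition hit l v := (M K v == d.+1%:Z) && (1 <= M (A l) v).

(** Exchanging an entry x of [A l] for a typical a keeps the list minimal, so the marginal of v
    stays at least d + 1 and c a v >= c x v. Choosing x with c x v >= 1, every hit vertex is charged
    to the degree of a. *)
Lemma cnt_hit_le l : cnt (hit l) <= L.
Proof.
have [a Pa aK] := exists_typical l; have [AP _ _ _] := Ac.
have a1 x : x \in A l -> c x a = 1.
  by have [_ h _] := marg_tight Ac Pa (etrans aK (f_equal Posz (esym (As l)))); apply: h.
apply: le_trans (degL a); apply: tot_le => v.
have := c_ge0 a v; have [|_] := boolP (hit l v); last by [].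
move=> /andP[/eqP vK /exists_adj[x xA xv]] _.
have xo := opt_rem xA; have xK := mem_K xA.
have h1 := marg_rem a xK; have h2 := marg_rem v xK.
have sz := size_rem_K xK.
have ao : opt (a :: rem x K).
  rewrite /opt -[cost c _]/(M (rem x K) a + cost c (rem x K)).
  rewrite -[size _]/((size (rem x K)).+1) mu_size ?sz ?muln_gt0 ?p_gt0//.
  move: xo; rewrite /opt sz => ->.
  have -> : ((p * d.+1).-1 %/ p = d)%N.
    have -> : ((p * d.+1).-1 = d * p + p.-1)%N by rewrite mulnS mulnC; lia.
    by rewrite divnMDl// divn_small ?addn0//; lia.
  by rewrite aK a1// in h1; lia.
have := opt_marg v ao; rewrite -[size _]/((size (rem x K)).+1) sz.
rewrite -[_.+1.-1]/((p * d.+1)%N) mulKn// marg_cons ltnS leqnn => /(_ isT).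
by move: h2 xv; rewrite vK; lia.
Qed.

(** Y is the total degree of the parts and H the total excess of the marginals of K over d + 1. The
    truncated sum is the portion of the degree of z on which [rho] has slope 1. *)
Lemma final_int : exists Y H : int, [/\ 0 <= H, Y <= (p * d.+1)%:Z * L,
  Y + tot (fun v => if c z v <= d%:Z then c z v else 0) <=
    (p * d.+1)%:Z * L + d.+2%:Z * H &
  Y + tot (c z) = d.+1%:Z * N + H].
Proof.
exists (tot (M (parts A))), (tot (fun v => M K v - d.+1%:Z)); split.
- by apply: sumr_ge0 => v _; rewrite subr_ge0 marg_K_ge.
- have := tot_marg (parts A); suff -> : size (parts A) = (p * d.+1)%N by [].
  by have := size_K; case.
- have hU : \sum_l cnt (hit l) <= p%:Z * L.
    apply: (@le_trans _ _ (\sum_(l < p) L)); first by apply: ler_sum => l _; exact: cnt_hit_le.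
    by rewrite sumr_const card_ord -mulr_natr natz mulrC.
  (* The comparison is pointwise. A vertex with excess 0 is hit, or has its whole marginal d + 1
     from z and escapes the truncated sum; for excess h >= 1 use d + 1 + h <= (d + 2) h. *)
  apply: (@le_trans _ _ (d.+1%:Z * (\sum_l cnt (hit l)) +
    d.+2%:Z * tot (fun v => M K v - d.+1%:Z))); last by move: hU; rewrite PoszM; nia.
  rewrite /cnt -tot_sum -!totZ -!totD; apply: tot_le => v.
  pose X : int := \sum_l (hit l v : nat)%:Z; rewrite -/X.
  have X0 : 0 <= X by apply: sumr_ge0.
  have KE : M K v = c z v + M (parts A) v by rewrite marg_cons.
  have := marg_K_ge v; have := c_ge0 z v; have := marg_ge0 (parts A) v.
  rewrite KE; have [h|h] := eqVneq (M K v) d.+1%:Z; last first.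
    by move: h X0; rewrite KE; case: ifP => _; nia.
  have [/existsP[l Ul]|] := boolP [exists l, 1 <= M (A l) v].
    have X1 : 1 <= X.
      rewrite /X (bigD1 l)//= /hit h eqxx Ul /= lerDl.
      by apply: sumr_ge0.
    by move: h X1; rewrite KE; case: ifP => _; nia.
  rewrite negb_exists => /forallP nU.
  have M0 : M (parts A) v = 0.
    rewrite marg_parts big1// => l _; have := nU l; have := marg_ge0 (A l) v; lia.
  by move: h; rewrite KE M0; case: ifP => ?; nia.
rewrite -totD -tot_const -totD; apply: eq_tot => v.
by rewrite marg_cons; lia.
Qed.

End Final.
End Classes.

End Base.

Lemma core_int : exists z (Y H : int), [/\ 0 <= H, Y <= (p * d.+1)%:Z * L,
  Y + tot (fun v => if c z v <= d%:Z then c z v else 0) <=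
    (p * d.+1)%:Z * L + d.+2%:Z * H &
  Y + tot (c z) = d.+1%:Z * N + H].
Proof.
have [S Ss So] := @exists_opt (p * d).+1 ltac:(rewrite mulnS; lia).
have [y yz] := exists_ztup So Ss.
have [z [A [Ac As]]] := exists_config So Ss yz.
by exists z; exact: final_int Ac As.
Qed.

End Core.

(** * A vertex of large cost degree *)

(** Up to the factor [alpha], a two-slope lower bound for the logarithmic cost ([phi_ge]). *)
Definition rho (R : realFieldType) (g : R) (d : nat) (t : int) : R :=
  if t <= d%:Z then t%:~R else g * t%:~R.

Lemma rhoE (R : realFieldType) (g : R) d t :
  rho g d t = g * t%:~R - (g - 1) * (if t <= d%:Z then t else 0)%:~R.
Proof. by rewrite /rho; case: ifP => _; rewrite ?mulr0z; ring. Qed.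

Lemma rho_ge (R : realFieldType) (g : R) d t : 1 <= g -> t%:~R <= rho g d t.
Proof.
move=> g1; rewrite /rho; case: ifP => // /negbT td.
by rewrite ler_peMl// ler0z; lia.
Qed.

Theorem exists_large_degree (R : realFieldType) (V : finType) (c : V -> V -> int)
    (p d : nat) (g L : R) :
  (forall u v, c u v = c v u) -> (0 < p)%N -> (0 < #|V|)%N ->
  (forall l, size l = (p * d.+1).+2 -> (mu p (p * d.+1).+2)%:Z <= cost c l) ->
  1 <= g -> g * d.+1%:R < d.+2%:R ->
  (forall v, \sum_u rho g d (c v u) < L) ->
  g * d.+1%:R * #|V|%:R < (g * (p * d.+1)%:R + 1) * L.
Proof.
move=> csym p0 V0 cs g1 gd deg; rewrite ltNge; apply/negP => Lle.
have /card_gt0P[v0 _] := V0.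
pose vm := [arg max_(v > v0) tot (c v)]%O.
have degL0 v : tot (c v) <= tot (c vm).
  by rewrite /vm; case: arg_maxP => //= w _; apply.
have tot_lt v : (tot (c v))%:~R < L.
  apply: le_lt_trans (deg v); rewrite /tot (raddf_sum (intmul 1)) /=.
  by apply: ler_sum => u _; exact: rho_ge.
set L0 := tot (c vm) in degL0; have L0L : L0%:~R < L := tot_lt vm.
have D0 : 0 < d.+1%:R :> R by rewrite ltr0n.
have q0 : 0 <= (p * d.+1)%:R :> R by rewrite ler0n.
have N0 : 0 < #|V|%:R :> R by rewrite ltr0n.
(* The negated conclusion bounds L0 by g (d + 1) N / (g p (d + 1) + 1), and g (d + 1) < d + 2 makes
   this small enough for the integral core. *)
have L_small : L0 * (p * d.+2 + 1)%:Z < d.+2%:Z * #|V|%:Z.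
  rewrite -(ltr_int R) !intrM -!pmulrn.
  have [L00|L00] := leP L0%:~R (0 : R).
    apply: (@le_lt_trans _ _ 0); last by rewrite mulr_gt0 ?ltr0n.
    by rewrite mulr_le0_ge0.
  have h : (g * (p * d.+1)%:R + 1) * L0%:~R < g * d.+1%:R * #|V|%:R.
    apply: lt_le_trans Lle; rewrite ltr_pM2l//.
    by rewrite ltr_wpDl// mulr_ge0// (le_trans _ g1).
  have gD : 0 < g * d.+1%:R by rewrite mulr_gt0// (lt_le_trans _ g1).
  rewrite -(ltr_pM2l gD) mulrCA.
  have e1 : g * d.+1%:R * (L0%:~R * (p * d.+2 + 1)%:R) =
      d.+2%:R * ((g * (p * d.+1)%:R + 1) * L0%:~R) -
      (d.+2%:R - g * d.+1%:R) * L0%:~R :> R.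
    by rewrite natrD !natrM -(natr1 d.+1) -(natr1 d); ring.
  rewrite -mulrCA e1.
  have h2 : 0 < (d.+2%:R - g * d.+1%:R) * L0%:~R by rewrite mulr_gt0// subr_gt0.
  have h3 : d.+2%:R * ((g * (p * d.+1)%:R + 1) * L0%:~R) <
      d.+2%:R * (g * d.+1%:R * #|V|%:R) by rewrite ltr_pM2l// ltr0n.
  by move: h2 h3; lra.
have [z [Y [H [H0 Y1 Y2 Y3]]]] := core_int csym p0 V0 cs degL0 L_small.
have hz := deg z.
have zE : \sum_u rho g d (c z u) = g * (tot (c z))%:~R -
    (g - 1) * (tot (fun v => if c z v <= d%:Z then c z v else 0))%:~R.
  rewrite /tot !(raddf_sum (intmul 1)) /= !mulr_sumr -sumrB.
  by apply: eq_bigr => u _; exact: rhoE.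
rewrite {}zE in hz.
set T := tot (fun _ => _) in Y2 hz.
have H0' : 0 <= H%:~R :> R by rewrite ler0z.
have Y1' : Y%:~R <= (p * d.+1)%:R * L0%:~R :> R.
  by rewrite -(ler_int R) intrM -pmulrn in Y1.
have Y2' : Y%:~R + T%:~R <= (p * d.+1)%:R * L0%:~R + d.+2%:R * H%:~R :> R.
  by rewrite -(ler_int R) !intrD !intrM -!pmulrn in Y2.
have Y3' : Y%:~R + (tot (c z))%:~R = d.+1%:R * #|V|%:R + H%:~R :> R.
  by rewrite -intrD Y3 intrD intrM -!pmulrn.
have k1 := ler_wpM2l (_ : 0 <= g - 1) Y2'; rewrite subr_ge0 in k1.
have {}k1 := k1 g1.
have k2 : (d.+2%:R - g * d.+1%:R) * H%:~R >= 0 by rewrite mulr_ge0// subr_ge0 ltW.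
have k3 : g * (p * d.+1)%:R * L0%:~R <= g * (p * d.+1)%:R * L.
  by apply: ler_wpM2l; [rewrite mulr_ge0// (le_trans _ g1)|exact: ltW].
have d2 : d.+2%:R = d.+1%:R + 1 :> R by rewrite -natr1.
rewrite d2 in k1 k2.
have k4 : g * (Y%:~R + (tot (c z))%:~R) = g * (d.+1%:R * #|V|%:R + H%:~R) by rewrite Y3'.
move: Lle hz Y1' k1 k2 k3 k4.
move: (Y%:~R) (T%:~R) (H%:~R) (L0%:~R) ((tot (c z))%:~R) (#|V|%:R) ((p * d.+1)%:R) (d.+1%:R : R).
move=> y t h l0 tz n q D *; lra.
Qed.

(** * Logarithmic costs *)

Lemma big_pairs_setU1 (T : Type) (idx : T) (op : Monoid.com_law idx)
    (V : finType) (F : {set V} -> T) (U : {set V}) (v : V) : v \notin U ->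
  \big[op/idx]_(A : {set V} | (A \subset (v |: U)%SET) && (#|A| == 2)) F A =
  op (\big[op/idx]_(u in U) F [set u; v]%SET)
     (\big[op/idx]_(A : {set V} | (A \subset U) && (#|A| == 2)) F A).
Proof.
move=> vU; rewrite (bigID (fun A : {set V} => v \in A)) /=; congr (op _ _); last first.
  apply: eq_bigl => A; have [vA|vA] /= := boolP (v \in A).
    rewrite andbF; apply/esym/negP => /andP[/fintype.subsetP/(_ v vA)].
    by rewrite (negbTE vU).
  rewrite andbT; congr (_ && _); apply/fintype.subsetP/fintype.subsetP => h x xA.
    have := h x xA; rewrite in_setU1 => /orP[/eqP xv|//].
    by rewrite -xv xA in vA.
  by rewrite in_setU1 h ?orbT.
pose h (A : {set V}) := odflt v [pick u in (A :\ v)%SET].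
have hE u : u != v -> h [set u; v]%SET = u.
  move=> uv; rewrite /h; have -> : ([set u; v] :\ v = [set u])%SET.
    apply/setP => w; rewrite !inE; case: (eqVneq w v) => [->|_] /=.
      by rewrite eq_sym (negbTE uv).
    by rewrite orbF.
  by case: pickP => [w|/(_ u)]; rewrite inE ?eqxx// => /eqP.
rewrite (reindex_onto (fun u => [set u; v]%SET) h).
  apply: eq_bigl => u; have [->|uv] := eqVneq u v.
    rewrite (negbTE vU) finset.setUid cards1; apply/negbTE.
    by rewrite !negb_and orbT.
  rewrite hE// eqxx andbT !inE eqxx orbT andbT cards2 uv andbT.
  rewrite finset.subUset !finset.sub1set !inE eqxx orTb andbT (negbTE uv) //=.
move=> A /andP[/andP[AU /cards2P[x [w [xw AE]]]] vA].
move: vA; rewrite AE !inE => /orP[/eqP vx|/eqP vw].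
  have -> : [set x; w]%SET = [set w; v]%SET by rewrite vx finset.setUC.
  by rewrite hE// vx eq_sym.
by rewrite -vw hE// vw.
Qed.

Section Phi.
Variable (R : realType).

Definition delta (w : nat) : R := ln w.+1%:R - ln w%:R.

Lemma delta_anti w w' : (0 < w)%N -> (w <= w')%N -> delta w' <= delta w.
Proof.
move=> w0 ww'; have w'0 := leq_trans w0 ww'.
rewrite /delta -!ln_div ?posrE ?ltr0n// ler_ln ?posrE ?divr_gt0 ?ltr0n//.
rewrite -!natr1 !mulrDl !divff ?pnatr_eq0 -?lt0n// lerD2l !mul1r.
by rewrite lef_pV2 ?posrE ?ltr0n// ler_nat.
Qed.

Lemma delta_gt0 w : (0 < w)%N -> 0 < delta w.
Proof. by move=> w0; rewrite /delta subr_gt0 ltr_ln ?posrE ?ltr0n// ltr_nat. Qed.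

Definition phi (a w : nat) : R := ln a.+1%:R - ln w%:R.

Lemma phi_step a k : (k <= a)%N -> phi a (a.+1 - k) = \sum_(i < k) delta (a - i).
Proof.
elim: k => [|k IHk] ka; first by rewrite big_ord0 /phi subn0 subrr.
rewrite big_ord_recr /= -IHk 1?ltnW// /phi /delta subSS.
have -> : (a.+1 - k = (a - k).+1)%N by rewrite subSn// ltnW.
by lra.
Qed.

Lemma phi_step_neg a k : phi a (a.+1 + k) = - \sum_(i < k) delta (a.+1 + i).
Proof.
elim: k => [|k IHk]; first by rewrite big_ord0 /phi addn0 subrr oppr0.
rewrite big_ord_recr /= opprD -IHk /phi /delta addnS; lra.
Qed.

Variables (a d : nat).
Hypothesis da : (d ^ 2 + d < a)%N.

Let a_gt0 : (0 < a)%N. Proof. exact: leq_ltn_trans da. Qed.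

Let d_lt_a : (d < a)%N. Proof. by apply: leq_ltn_trans da; rewrite leq_addl. Qed.

Definition alpha : R := phi a a.

Definition beta : R := phi a (a - d).

(** The ratio g of the two slopes: the mean growth of the logarithmic cost over the first d + 1
    units, relative to the first unit. *)
Definition slope : R := beta / (d.+1%:R * alpha).

Lemma alphaE : alpha = delta a.
Proof. by []. Qed.

Lemma alpha_gt0 : 0 < alpha.
Proof. exact: delta_gt0. Qed.

Lemma betaE : beta = \sum_(i < d.+1) delta (a - i).
Proof. by rewrite -phi_step// subSS. Qed.

Lemma beta_ge : d.+1%:R * alpha <= beta.
Proof.
rewrite betaE mulr_natl -[X in _ *+ X]card_ord -sumr_const; apply: ler_sum => i _.
by rewrite alphaE delta_anti ?leq_subr// subn_gt0 (leq_trans (ltn_ord i)).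
Qed.

Lemma beta_le : beta <= d.+1%:R * delta (a - d).
Proof.
rewrite betaE mulr_natl -[X in _ *+ X]card_ord -sumr_const; apply: ler_sum => i _.
by rewrite delta_anti ?subn_gt0// leq_sub2l// -ltnS.
Qed.

Lemma beta_gt0 : 0 < beta.
Proof. by apply: lt_le_trans beta_ge; rewrite mulr_gt0 ?ltr0n ?alpha_gt0. Qed.

Lemma slope_ge1 : 1 <= slope.
Proof.
by rewrite /slope ler_pdivlMr ?mul1r ?beta_ge// mulr_gt0 ?ltr0n ?alpha_gt0.
Qed.

Lemma exp1D_ge (y : R) m : 0 <= y ->
  1 + m%:R * y + m%:R * (m%:R - 1) / 2 * y ^+ 2 <= (1 + y) ^+ m.
Proof.
move=> y0; elim: m => [|m IHm]; first by rewrite expr0; lra.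
rewrite [(1 + y) ^+ _]exprSr; have y1 : 0 <= 1 + y by lra.
have /= := ler_wpM2r y1 IHm; apply: le_trans; rewrite -subr_ge0.
set k : R := m%:R; have -> : m.+1%:R = k + 1 :> R by rewrite -natr1.
have k0 : 0 <= k * (k - 1).
  rewrite /k; case: (m) => [|m']; first by rewrite mul0r.
  by rewrite mulr_ge0// subr_ge0 ler1n.
(* The cubic term is exactly what the induction step discards. *)
have : 0 <= k * (k - 1) / 2 * y ^+ 3 by rewrite mulr_ge0 ?exprn_ge0// divr_ge0.
by lra.
Qed.

(* The only place where a > d^2 + d is needed in full. *)
Lemma beta_lt : beta < d.+2%:R * alpha.
Proof.
have ad0 : (0 < a - d)%N by rewrite subn_gt0.
have [aR adR] : (0 < a%:R :> R) /\ (0 < (a - d)%:R :> R) by rewrite !ltr0n.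
suff : ln (a%:R / (a - d)%:R) < d.+1%:R * alpha.
  rewrite ln_div ?posrE// /beta /alpha /phi -(natr1 d.+1) mulrDl mul1r => h.
  by move: h; set X := _ * (_ - _); lra.
have alE : alpha = ln (1 + a%:R^-1).
  rewrite /alpha /phi -ln_div ?posrE ?ltr0n// -natr1 mulrDl divff ?mul1r//.
  by rewrite pnatr_eq0 -lt0n.
set y : R := a%:R^-1; have y0 : 0 < y by rewrite invr_gt0.
rewrite alE [d.+1%:R * _]mulr_natl -lnXn ?addr_gt0// ltr_ln ?posrE ?divr_gt0 ?exprn_gt0 ?addr_gt0//.
apply: lt_le_trans (exp1D_ge _ (ltW y0)).
rewrite ltr_pdivrMr//.
have -> : (a - d)%:R = a%:R * (1 - d%:R * y).
  by rewrite natrB 1?ltnW// mulrBr mulr1 mulrCA /y divff ?mulr1// gt_eqF.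
rewrite mulrCA ltr_pMr//.
set k : R := d%:R; have -> : d.+1%:R = k + 1 :> R by rewrite -natr1.
have k0 : 0 <= k by [].
have ky : k * (k + 1) * y < 1.
  rewrite /y ltr_pdivrMr// mul1r.
  have -> : k * (k + 1) = (d ^ 2 + d)%:R by rewrite natrD natrX /k; ring.
  by rewrite ltr_nat.
have ky2 : k * y * (k * (k + 1) * y) <= k * y.
  by apply: ler_piMr; [rewrite mulr_ge0// ltW|exact: ltW].
have ky1 : k * y <= k * (k + 1) * y.
  by apply: ler_wpM2r; [exact: ltW|rewrite ler_peMr//; lra].
(* The second-order bound times 1 - d y exceeds 1 by exactly this product, and each subtracted term
   is below 1/2. *)
have : 0 < y * (1 - k * (k + 1) / 2 * y - k * y * (k * (k + 1) * y) / 2).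
  by apply: mulr_gt0 => //; lra.
by lra.
Qed.

Lemma slope_lt : slope * d.+1%:R < d.+2%:R.
Proof.
have h : slope * d.+1%:R = beta / alpha.
  have an0 : alpha != 0 by rewrite gt_eqF ?alpha_gt0.
  have Dn0 : d.+1%:R != 0 :> R by rewrite pnatr_eq0.
  rewrite /slope; move: (d.+1%:R) Dn0 => D Dn0.
  by field; rewrite an0 Dn0.
by rewrite h ltr_pdivrMr ?alpha_gt0// beta_lt.
Qed.

(** The increments [delta] grow as the multiplicity drops. Up to cost d each is at least [alpha];
    beyond d + 1 each is at least the mean of the first d + 1; for negative costs each is at most
    [alpha]. *)
Lemma phi_ge w : (0 < w)%N ->
  alpha * rho slope d (a.+1%:Z - w%:Z) <= phi a w.
Proof.
move=> w0; have [wa|wa] := leqP w a.+1; last first.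
  have [k wE] : exists k, w = (a.+1 + k)%N by exists (w - a.+1)%N; lia.
  have -> : a.+1%:Z - w%:Z = - k%:Z by lia.
  rewrite /rho ifT; last by lia.
  rewrite wE phi_step_neg mulrNz mulrN lerN2 mulrC -pmulrn mulr_natl.
  rewrite -[X in _ *+ X]card_ord -sumr_const; apply: ler_sum => i _.
  by rewrite alphaE delta_anti//; lia.
have [k kE] : exists k, (w = a.+1 - k)%N /\ (k <= a)%N by exists (a.+1 - w)%N; lia.
case: kE => wE ka; have -> : a.+1%:Z - w%:Z = k%:Z by lia.
rewrite wE phi_step// /rho -pmulrn; case: ifP => kd.
  rewrite mulr_natr -[X in _ *+ X]card_ord -sumr_const; apply: ler_sum => i _.
  by rewrite alphaE delta_anti ?leq_subr//; have := ltn_ord i; lia.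
have [m mE] : exists m, k = (d.+1 + m)%N by exists (k - d.+1)%N; lia.
rewrite mE big_split_ord /= -betaE.
have -> : alpha * (slope * (d.+1 + m)%:R) = beta + m%:R * (beta / d.+1%:R).
  have an0 : alpha != 0 by rewrite gt_eqF ?alpha_gt0.
  have Dn0 : d.+1%:R != 0 :> R by rewrite pnatr_eq0.
  rewrite /slope natrD; move: (d.+1%:R) Dn0 => D Dn0.
  by field; rewrite an0 Dn0.
rewrite lerD2l mulr_natl -[X in _ *+ X]card_ord -sumr_const; apply: ler_sum => i _.
apply: (@le_trans _ _ (delta (a - d))).
  by rewrite ler_pdivrMr ?ltr0n// mulrC beta_le.
by apply: delta_anti; have := ltn_ord i; lia.
Qed.

End Phi.

(** * The pattern *)

Lemma bin2_double n : ('C(n, 2) * 2 = n * n.-1)%N.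
Proof. by rewrite mulnC -mul_bin_diag bin1. Qed.

(** The difference of the two sides is (n - k) (n - k - 1) / 2, a product of consecutive integers
    halved. *)
Lemma bin2_tangent n k : (k * n <= 'C(n, 2) + 'C(k.+1, 2))%N.
Proof.
have := bin2_double n; have := bin2_double k.+1 => /=.
move: 'C(n, 2) 'C(k.+1, 2) => x y hy hx.
have : (0 <= (n%:Z - k%:Z) * (n%:Z - k%:Z - 1))%R.
  have [nk|nk] := leP n%:Z k%:Z; first by rewrite mulr_le0; lia.
  by rewrite mulr_ge0; lia.
case: n hx => [|n] /= hx; nia.
Qed.

Section Pattern.
Variables (p d a : nat) (V : finType) (P : pattern V) (vl : V).
Hypothesis V_card : #|V| = p.+1.
Hypothesis d_lt_a : (d < a)%N.
Hypothesis P_pair : forall u v, P [set u; v]%SET =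
  (if u == v then (if v == vl then a - d else a) else a.+1)%N.

Let loss v : nat := if v == vl then d.+1 else 1%N.

Lemma edge_sum_blowup n (f : {ffun 'I_n -> V}) :
  (edge_sum (blowup P f) [set: 'I_n]%SET +
    \sum_v loss v * 'C(#|[set x | f x == v]%SET|, 2) = a.+1 * 'C(n, 2))%N.
Proof.
have -> : (\sum_v loss v * 'C(#|[set x | f x == v]%SET|, 2) =
    \sum_(A : {set 'I_n} | (A \subset [set: 'I_n]%SET) && (#|A| == 2))
      \sum_v loss v * (A \subset [set x | f x == v]%SET))%N.
  rewrite exchange_big /=; apply: eq_bigr => v _.
  rewrite -big_distrr /=; congr (_ * _)%N.
  rewrite -cards_draws -sum1_card big_mkcond [RHS]big_mkcond /=.
  apply: eq_bigr => A _; rewrite !inE finset.subsetT /= andbC.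
  by case: (#|A| == 2); case: (A \subset _).
have -> : (a.+1 * 'C(n, 2) =
    \sum_(A : {set 'I_n} | (A \subset [set: 'I_n]%SET) && (#|A| == 2)) a.+1)%N.
  rewrite sum_nat_const mulnC -[X in 'C(X, 2)]card_ord -cardsT -cards_draws.
  by congr (_ * _)%N; apply: eq_card => A; rewrite !inE.
rewrite /edge_sum -big_split /=; apply: eq_bigr => A /andP[_ /cards2P[x [y [xy ->]]]].
rewrite blowupE P_pair.
have sE v : ([set x; y]%SET \subset [set x | f x == v]%SET) = (f x == v) && (f y == v).
  by rewrite finset.subUset !finset.sub1set !inE.
have [fxy|fxy] := eqVneq (f x) (f y).
  rewrite (bigD1 (f y)) //= sE fxy eqxx muln1 big1 ?addn0; last first.
    by move=> v vy; rewrite sE fxy eq_sym (negbTE vy) muln0.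
  by rewrite /loss; case: eqP => _; lia.
rewrite big1 ?addn0// => v _; rewrite sE.
case: eqP => [<-|]; last by rewrite muln0.
by rewrite eq_sym (negbTE fxy) muln0.
Qed.

Lemma loss_ge (m : V -> nat) : (0 < p)%N -> (\sum_v m v = (p * d.+1).+2)%N ->
  (mu p (p * d.+1).+2 <= \sum_v loss v * 'C(m v, 2))%N.
Proof.
move=> p0 ms.
have -> : mu p (p * d.+1).+2 = (p * 'C(d.+1, 2) + d.+1)%N.
  by have := @muE p d.+1 1 p0 p0; rewrite addn1 mul1n.
move: ms; rewrite (bigD1 vl)//= [in X in _ -> X](bigD1 vl)//= {1}/loss eqxx.
rewrite [in X in _ -> X](eq_bigr (fun v => 'C(m v, 2))); last first.
  by move=> v /negbTE vvl; rewrite /loss vvl mul1n.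
have tang k : (k * (\sum_(v | v != vl) m v) <=
    \sum_(v | v != vl) 'C(m v, 2) + p * 'C(k.+1, 2))%N.
  have -> : (p * 'C(k.+1, 2) = \sum_(v | v != vl) 'C(k.+1, 2))%N.
    by rewrite sum_nat_const cardC1 V_card.
  by rewrite big_distrr -big_split /=; apply: leq_sum => v _; exact: bin2_tangent.
have := tang d; have := tang d.+1.
move: (\sum_(v | _) m v)%N (\sum_(v | _) 'C(m v, 2))%N (m vl) => Y X z.
rewrite binS bin1; have := bin2_double d.+1 => /=.
have := bin2_tangent z 1; rewrite binn mul1n.
move: 'C(d.+1, 2) 'C(z, 2) => D Z hZ hD h1 h2 h3.
(* With at least two vertices in the class of [vl] the line of slope d suffices, otherwise that of
   slope d + 1. *)
have [z2|z2] := leqP 2 z; nia.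
Qed.

Lemma Sigma_le : (0 < p)%N ->
  (Sigma P (p * d.+1).+2 + mu p (p * d.+1).+2 <= a.+1 * 'C((p * d.+1).+2, 2))%N.
Proof.
move=> p0; set s := (p * d.+1).+2.
have h (f : {ffun 'I_s -> V}) : (edge_sum (blowup P f) [set: 'I_s]%SET + mu p s <=
    a.+1 * 'C(s, 2))%N.
  have sm : (\sum_v #|[set x | f x == v]%SET| = s)%N.
    rewrite -[RHS]card_ord -sum1_card (partition_big f xpredT)//=.
    by apply: eq_bigr => v _; rewrite -sum1_card; apply: eq_bigl => x; rewrite inE.
  by rewrite -(edge_sum_blowup f) leq_add2l loss_ge.
have mus := leq_trans (leq_addl _ _) (h [ffun=> vl]).
rewrite addnC -leq_subRL//.
by apply/bigmax_leqP => f _; rewrite leq_subRL// addnC h.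
Qed.

(** Enumerating an s-set turns the restriction of a blow-up into a blow-up on s vertices. *)
Lemma blowup_sq n (f : {ffun 'I_n -> V}) s : is_sq_graph s (Sigma P s) (blowup P f).
Proof.
move=> X Xs; subst s.
pose f' := [ffun i : 'I_#|X| => f (enum_val i)].
apply: leq_trans (leq_bigmax f'); rewrite /edge_sum.
pose h (B : {set 'I_#|X|}) := [set enum_val i | i in B]%SET.
rewrite (reindex_onto h (fun A => [set i | enum_val i \in A]%SET)) /=; last first.
  move=> A /andP[AX _]; apply/setP => x; apply/imsetP/idP => [[i]|xA].
    by rewrite inE => iA ->.
  have xX := fintype.subsetP AX x xA.
  by exists (enum_rank_in xX x); rewrite ?inE enum_rankK_in.
rewrite big_mkcond [leqRHS]big_mkcond /=; apply: leq_sum => B _.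
case: ifP => // /andP[/andP[_ B2] _].
rewrite finset.subsetT /= -(card_imset B enum_val_inj) B2.
rewrite /blowup /h -imset_comp (_ : (f \o _) @: B = f' @: B)%SET//.
by apply: eq_imset => i /=; rewrite ffunE.
Qed.

Section Pi.
Variable R : realType.
Hypothesis da : (d ^ 2 + d < a)%N.
Let al : R := alpha R a.
Let be : R := beta R a d.

Let pv v : R := if v == vl then be else al.

Lemma pv_gt0 v : 0 < pv v.
Proof. by rewrite /pv; case: ifP => _; [exact: beta_gt0|exact: alpha_gt0 da]. Qed.

(** The minimum over the simplex of the sum of the [pv v * x v ^+ 2], attained at [xopt]. *)
Definition cst : R := (p%:R / al + be^-1)^-1.

Lemma sum_pv : \sum_v (pv v)^-1 = cst^-1.
Proof.
rewrite /cst invrK (bigD1 vl)//= {1}/pv eqxx addrC; congr (_ + _).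
rewrite (eq_bigr (fun=> al^-1)); last by move=> v /negbTE vvl; rewrite /pv vvl.
by rewrite sumr_const cardC1 V_card /= mulr_natl.
Qed.

Lemma cst_gt0 : 0 < cst.
Proof.
rewrite invr_gt0 ltr_wpDl ?invr_gt0 ?beta_gt0// mulr_ge0// invr_ge0 ltW//.
exact: alpha_gt0 da.
Qed.

Lemma log_multE u v : log_mult R P u v = ln a.+1%:R - (if u == v then pv v else 0).
Proof.
rewrite /log_mult P_pair; case: eqP => _; last by rewrite subr0.
by rewrite /pv; case: eqP => _; rewrite opprB addrC subrK.
Qed.

Definition xopt v : R := cst / pv v.

Lemma xopt_ge0 v : 0 <= xopt v.
Proof. by rewrite divr_ge0 ?ltW ?cst_gt0 ?pv_gt0. Qed.

Lemma sum_xopt : \sum_v xopt v = 1.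
Proof. by rewrite -mulr_sumr sum_pv divff// gt_eqF ?cst_gt0. Qed.

Lemma sum_log_mult_xopt u : \sum_v log_mult R P u v * xopt v = ln a.+1%:R - cst.
Proof.
rewrite (eq_bigr (fun v => ln a.+1%:R * xopt v -
    (if u == v then pv v else 0) * xopt v)); last first.
  by move=> v _; rewrite log_multE mulrBl.
rewrite sumrB -mulr_sumr sum_xopt mulr1 (bigD1 u)//= eqxx big1 ?addr0; last first.
  by move=> v /negbTE vu; rewrite eq_sym vu mul0r.
by rewrite /xopt mulrC divfK// gt_eqF ?pv_gt0.
Qed.

Lemma pi_patternE : pi_pattern R P = ln a.+1%:R - cst.
Proof.
apply: maximum_eq.
  exists xopt; first by split; [exact: xopt_ge0|exact: sum_xopt].
  rewrite (eq_bigr (fun u => xopt u * (ln a.+1%:R - cst))); last first.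
    by move=> u _; rewrite -(sum_log_mult_xopt u) mulr_sumr; apply: eq_bigr => v _; rewrite mulrA.
  by rewrite -mulr_suml sum_xopt mul1r.
move=> _ [x [x0 x1] <-].
have -> : \sum_u \sum_v x u * log_mult R P u v * x v =
    ln a.+1%:R - \sum_u pv u * x u ^+ 2.
  rewrite (eq_bigr (fun u => x u * ln a.+1%:R - pv u * x u ^+ 2)).
    by rewrite sumrB -mulr_suml x1 mul1r.
  move=> u _; rewrite (eq_bigr (fun v => x u * ln a.+1%:R * x v -
      (if u == v then pv v else 0) * (x u * x v))); last first.
    by move=> v _; rewrite log_multE; ring.
  rewrite sumrB -mulr_sumr x1 mulr1 (bigD1 u)//= eqxx big1 ?addr0 ?expr2//.
  by move=> v /negbTE vu; rewrite eq_sym vu mul0r.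
rewrite lerD2l lerN2.
(* The tangent to the parabola at [xopt u]; summed over the simplex the tangents give [cst]. *)
have h u : cst *+ 2 * x u - cst ^+ 2 * (pv u)^-1 <= pv u * x u ^+ 2.
  have pu := pv_gt0 u.
  have -> : cst *+ 2 * x u - cst ^+ 2 * (pv u)^-1 =
      pv u * x u ^+ 2 - (pv u)^-1 * (pv u * x u - cst) ^+ 2.
    by field; rewrite gt_eqF.
  by rewrite gerBl mulr_ge0 ?invr_ge0 ?sqr_ge0// ltW.
apply: le_trans (ler_sum _ (fun u _ => h u)).
rewrite sumrB -!mulr_sumr x1 sum_pv mulr1 expr2 mulfK ?gt_eqF ?cst_gt0//.
by rewrite mulr2n addrK.
Qed.

End Pi.
End Pattern.

(** * The upper bound *)

Lemma exists_superset (T : finType) (A : {set T}) s : (#|A| <= s <= #|T|)%N ->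
  exists2 X : {set T}, A \subset X & #|X| = s.
Proof.
move=> /andP[As sT].
have /card_geqP[t [ut st tA]] : (s - #|A| <= #|~: A|%SET)%N.
  by rewrite leq_subLR cardsC.
exists (A :|: [set x in t])%SET; first exact: finset.subsetUl.
rewrite cardsU (_ : (A :&: [set x in t])%SET = finset.set0) ?cards0 ?subn0.
  by rewrite cardsE (card_uniqP ut) st subnKC.
apply/setP => x; rewrite !inE; apply/negP => /andP[xA /tA].
by rewrite inE xA.
Qed.

Lemma sq_graph_pair_le n s q (G : multigraph 'I_n) (A : {set 'I_n}) :
  is_sq_graph s q G -> (2 <= s <= n)%N -> #|A| = 2%N -> (G A <= q)%N.
Proof.
move=> Gq sn A2; have [X AX Xs] : exists2 X : {set 'I_n}, A \subset X & #|X| = s.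
  by apply: exists_superset; rewrite A2 card_ord.
by apply: leq_trans (Gq X Xs); rewrite /edge_sum (bigD1 A) ?AX ?A2//= leq_addr.
Qed.

Lemma cost_ge (W : finType) (c : W -> W -> int) (Q : int) (l : seq W) :
  (forall u v, - Q <= c u v) -> - ('C(size l, 2)%:Z * Q) <= cost c l.
Proof.
move=> cQ; elim: l => [|v l IHl] /=; first by rewrite mul0r.
have : - ((size l)%:Z * Q) <= marg c l v.
  elim: l {IHl} => [|w l IHl]; first by rewrite /marg big_nil mul0r.
  by rewrite marg_cons /=; have := cQ w v; lia.
by rewrite binS bin1; lia.
Qed.

Lemma cost_nonuniq_ge (W : finType) (c : W -> W -> int) (Q B : int) (l : seq W) :
  0 <= Q -> (forall u v, - Q <= c u v) -> (forall v, B <= c v v) -> ~~ uniq l ->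
  B - 'C(size l, 2)%:Z * Q <= cost c l.
Proof.
move=> Q0 cQ cB; elim: l => [//|v l IHl] /=; rewrite negb_and negbK.
have mge l' : - ((size l')%:Z * Q) <= marg c l' v.
  elim: l' => [|w l' IH]; first by rewrite /marg big_nil mul0r.
  by rewrite marg_cons /=; have := cQ w v; lia.
rewrite binS bin1 => /orP[vl|/IHl]; last by have := mge l; lia.
have := cost_ge l cQ; rewrite (marg_perm c v (perm_to_rem vl)) marg_cons.
have := mge (rem v l); rewrite size_rem//; have := cB v.
have : (0 < size l)%N by case: (l) vl.
by case: (size l) => // m _ /=; lia.
Qed.

Lemma cost_uniq (n a : nat) (G : multigraph 'I_n) (W : finType) (e : W -> 'I_n)
    (c : W -> W -> int) (l : seq W) : injective e ->
  (forall u v, u != v -> c u v = a.+1%:Z - (G [set e u; e v]%SET)%:Z) -> uniq l ->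
  cost c l + (edge_sum G [set x in map e l]%SET)%:Z = a.+1%:Z * 'C(size l, 2)%:Z.
Proof.
move=> e_inj cE; elim: l => [|v l IHl] /=.
  rewrite /edge_sum big1 ?mulr0// => A /andP[/fintype.subsetP A0 /cards2P[x [y [_ AE]]]].
  by have := A0 x; rewrite AE !inE eqxx => /(_ isT).
move=> /andP[vl ul]; have {IHl} := IHl ul.
have -> : [set x in e v :: map e l]%SET = (e v |: [set x in map e l])%SET.
  by apply/setP => x; rewrite !inE.
rewrite /edge_sum big_pairs_setU1 /=; last by rewrite inE mem_map.
rewrite (eq_bigl (mem (map e l))); last by move=> x; rewrite inE.
rewrite -big_uniq ?map_inj_uniq//= big_map.
have -> : marg c l v = a.+1%:Z * (size l)%:Z - (\sum_(w <- l) G [set e w; e v]%SET)%N%:Z.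
  rewrite /marg; elim: (l) vl => [|w l' IH]; first by rewrite !big_nil mulr0.
  rewrite inE negb_or => /andP[wv vl']; rewrite !big_cons (IH vl') cE 1?eq_sym//=.
  by rewrite PoszD; move: (\sum_(_ <- l') _)%N => X; lia.
rewrite binS bin1; move: (\sum_(_ <- l) _)%N (\sum_(_ | _) _)%N => X Y.
by rewrite PoszD; lia.
Qed.

Lemma ln_edge_prod (R : realType) n (G : multigraph 'I_n) :
  (forall A : {set 'I_n}, #|A| = 2%N -> (0 < G A)%N) ->
  ln (edge_prod G [set: 'I_n]%SET)%:R =
  \sum_(A : {set 'I_n} | (A \subset [set: 'I_n]%SET) && (#|A| == 2)) ln (G A)%:R :> R.
Proof.
move=> G_gt0; rewrite /edge_prod natr_prod.
suff [] : 0 < \prod_(A : {set 'I_n} |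
      (A \subset [set: 'I_n]%SET) && (#|A| == 2)) (G A)%:R :> R /\
    ln (\prod_(A : {set 'I_n} |
      (A \subset [set: 'I_n]%SET) && (#|A| == 2)) (G A)%:R) =
    \sum_(A : {set 'I_n} | (A \subset [set: 'I_n]%SET) && (#|A| == 2))
      ln (G A)%:R :> R by [].
apply: (big_rec2 (fun x y => 0 < x /\ ln x = y)); first by rewrite ln1.
move=> A x y /andP[_ /eqP A2] [y0 yE].
have GA : 0 < (G A)%:R :> R by rewrite ltr0n G_gt0.
by rewrite mulr_gt0//; split => //; rewrite lnM ?posrE// yE.
Qed.

Section Upper.
Variables (R : realType) (p d a n q : nat) (G : multigraph 'I_n).
Local Notation s := (p * d.+1).+2.
Hypothesis p_gt0 : (0 < p)%N.
Hypothesis da : (d ^ 2 + d < a)%N.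
Hypothesis q_le : (q + mu p s <= a.+1 * 'C(s, 2))%N.
Hypothesis G_sq : is_sq_graph s q G.
Hypothesis G_gt0 : forall A : {set 'I_n}, #|A| = 2%N -> (0 < G A)%N.
Hypothesis G_le : forall A : {set 'I_n}, #|A| = 2%N -> (G A <= q)%N.

(* As the cost of a repeated vertex, B makes every list with repetitions
   expensive enough, and changes the degrees by a constant only. *)
Let B := (mu p s + 'C(s, 2) * q)%N.
Let K : R := alpha R a * (slope R a d * B%:R).
Let C : R := cst p d a R.

(** If no vertex qualifies, [phi_ge] makes all [rho]-degrees smaller than C / alpha times the order
    of U, to which [exists_large_degree] applies. *)
Lemma exists_large_cost_degree (U : {set 'I_n}) : (0 < #|U|)%N ->
  exists2 v, v \in U &
    C * #|U|%:R - K <= \sum_(u in (U :\ v)%SET) phi R a (G [set u; v]%SET).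
Proof.
move=> U0.
have [/existsP[v /andP[vU vP]]|] := boolP [exists v, (v \in U) &&
  (C * #|U|%:R - K <= \sum_(u in (U :\ v)%SET) phi R a (G [set u; v]%SET))].
  by exists v.
rewrite negb_exists => /forallP nv; exfalso.
pose e (i : 'I_#|U|) := enum_val i.
have e_inj : injective e := enum_val_inj.
pose c i j : int := if i == j then B%:Z else a.+1%:Z - (G [set e i; e j]%SET)%:Z.
have al0 := alpha_gt0 R da; have be0 := beta_gt0 R da.
have D0 : 0 < d.+1%:R :> R by rewrite ltr0n.
have N0 : 0 < #|U|%:R :> R by rewrite ltr0n.
have p2 i j : i != j -> #|[set e i; e j]%SET| = 2%N.
  by move=> ij; rewrite cards2 (inj_eq e_inj) ij.
have cs l : size l = s -> (mu p s)%:Z <= cost c l.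
  move=> ls; have [ul|nul] := boolP (uniq l).
    have cE i j : i != j -> c i j = a.+1%:Z - (G [set e i; e j]%SET)%:Z.
      by rewrite /c => /negbTE ->.
    have cl : cost c l + (edge_sum G [set x in map e l]%SET)%:Z =
        a.+1%:Z * 'C(size l, 2)%:Z := cost_uniq e_inj cE ul.
    have eq : (edge_sum G [set x in map e l]%SET <= q)%N.
      apply: G_sq; rewrite cardsE -ls -(size_map e); apply/card_uniqP.
      by rewrite map_inj_uniq.
    move: cl eq q_le; rewrite ls; move: (cost c l) (edge_sum _ _) (mu p s) 'C(s, 2).
    by lia.
  have h1 : forall i j, - q%:Z <= c i j.
    move=> i j; rewrite /c; case: (eqVneq i j) => [_|ij]; first by lia.
    by have := G_le (p2 _ _ ij); lia.
  have h2 i : B%:Z <= c i i by rewrite /c eqxx.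
  have cl : B%:Z - 'C(size l, 2)%:Z * q%:Z <= cost c l.
    exact: cost_nonuniq_ge h1 h2 nul.
  by move: cl; rewrite ls /B PoszD PoszM addrK.
have csym i j : c i j = c j i by rewrite /c eq_sym finset.setUC.
have deg i : \sum_j rho (slope R a d) d (c i j) < C / alpha R a * #|U|%:R.
  have := nv (e i); rewrite enum_valP /= -ltNge => h.
  rewrite (bigD1 i)//= {1}/c eqxx.
  have rB : rho (slope R a d) d B%:Z <= slope R a d * B%:R.
    rewrite /rho; case: ifP => _; rewrite -pmulrn//.
    by rewrite ler_peMl// slope_ge1.
  have rS : alpha R a * (\sum_(j < #|U| | j != i) rho (slope R a d) d (c i j)) <=
      \sum_(u in (U :\ e i)%SET) phi R a (G [set u; e i]%SET).
    rewrite [leRHS](reindex_onto e (enum_rank_in (enum_valP i))) /=; last first.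
      by move=> u; rewrite !inE => /andP[_ uU]; rewrite /e enum_rankK_in.
    rewrite [leRHS](eq_bigl (fun j => j != i)); last first.
      move=> j; rewrite !inE enum_valP andbT (inj_eq e_inj) /e enum_valK_in eqxx andbT//.
    rewrite mulr_sumr; apply: ler_sum => j ji; rewrite csym /c (negbTE ji).
    by apply: phi_ge => //; apply: G_gt0; exact: p2.
  rewrite -(ltr_pM2l al0) mulrDr.
  have -> : alpha R a * (C / alpha R a * #|U|%:R) = C * #|U|%:R.
    by rewrite mulrA mulrCA divff ?mulr1// gt_eqF.
  have : alpha R a * rho (slope R a d) d B%:Z <= K by rewrite /K ler_pM2l.
  by move: h rS; lra.
have := @exists_large_degree R _ c p d _ _ csym p_gt0 _ cs (slope_ge1 R da) (slope_lt R da) deg.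
rewrite card_ord => /(_ U0).
(* Since (p / alpha + 1 / beta) C = 1, the two sides of the strict inequality coincide. *)
have -> : (slope R a d * (p * d.+1)%:R + 1) * (C / alpha R a * #|U|%:R) =
    slope R a d * d.+1%:R * #|U|%:R.
  rewrite /C /cst /slope natrM.
  have an0 : alpha R a != 0 by rewrite gt_eqF.
  have bn0 : beta R a d != 0 by rewrite gt_eqF.
  have Dn0 : d.+1%:R != 0 :> R by rewrite gt_eqF.
  have dn0 : p%:R * beta R a d + alpha R a != 0.
    by rewrite gt_eqF// ltr_wpDl// mulr_ge0// ltW.
  move: (alpha R a) (beta R a d) (d.+1%:R) (p%:R) an0 bn0 Dn0 dn0 => x y D P xn0 yn0 Dn0 dn0.
  by field; rewrite xn0 yn0 Dn0 /= dn0.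
by rewrite ltxx.
Qed.

(** Deleting vertices of large cost degree one by one, the bounds C m - K for m from 1 to the order
    of U add up to at least this. *)
Lemma sum_phi_ge (U : {set 'I_n}) :
  C * #|U|%:R ^+ 2 / 2 - K * #|U|%:R <=
  \sum_(A : {set 'I_n} | (A \subset U) && (#|A| == 2)) phi R a (G A).
Proof.
have [m] := ubnP #|U|; elim: m U => // m IHm U Um.
have C0 : 0 < C by exact: cst_gt0.
have [U0|U0] := posnP #|U|.
  rewrite U0 big1 ?expr0n ?mulr0 ?mul0r ?subr0//= => A /andP[AU /eqP A2].
  by have := subset_leq_card AU; rewrite U0 A2.
have [v vU vP] := exists_large_cost_degree U0.
have -> : \sum_(A : {set 'I_n} | (A \subset U) && (#|A| == 2)) phi R a (G A) =
    \sum_(u in (U :\ v)%SET) phi R a (G [set u; v]%SET) +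
    \sum_(A : {set 'I_n} | (A \subset (U :\ v)%SET) && (#|A| == 2)) phi R a (G A).
  by rewrite -{1}(finset.setD1K vU) big_pairs_setU1// !inE eqxx.
have cU : #|U| = #|(U :\ v)%SET|.+1 by rewrite (cardsD1 v U) vU.
have := IHm (U :\ v)%SET; rewrite -ltnS -cU => /(_ Um).
rewrite cU -natr1 in vP *; move: vP.
move: (\sum_(u in _) phi R a (G [set u; v]%SET)) (\sum_(A : {set 'I_n} | _) _).
by move: (#|_|%:R : R) => N X Y; lra.
Qed.

Lemma ln_edge_prod_le :
  ln (edge_prod G [set: 'I_n]%SET)%:R <=
  (ln a.+1%:R - C) * 'C(n, 2)%:R + K * n%:R.
Proof.
have := sum_phi_ge [set: 'I_n]%SET; rewrite ln_edge_prod// /phi sumrB sumr_const.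
have -> : #|[pred A : {set 'I_n} | (A \subset [set: 'I_n]%SET) && (#|A| == 2)]| = 'C(n, 2).
  rewrite -[X in 'C(X, 2)]card_ord -cardsT -cards_draws.
  by apply: eq_card => A; rewrite !inE.
rewrite cardsT card_ord -mulr_natr.
have C0 : 0 < C by exact: cst_gt0.
have : C * 'C(n, 2)%:R <= C * n%:R ^+ 2 / 2.
  rewrite -mulrA ler_pM2l// ler_pdivlMr// -natrX -natrM ler_nat bin2_double.
  by rewrite expnS expn1 leq_mul2l leq_pred orbT.
by move: (\sum_(A : {set 'I_n} | _) _) => X; lra.
Qed.

End Upper.

(** * The limit *)

Section Limit.
Variables (R : realType) (p d a : nat) (V : finType) (P : pattern V) (vl : V).
Local Notation s := (p * d.+1).+2.
Hypothesis p_gt0 : (0 < p)%N.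
Hypothesis da : (d ^ 2 + d < a)%N.
Hypothesis V_card : #|V| = p.+1.
Hypothesis P_pair : forall u v, P [set u; v]%SET =
  (if u == v then (if v == vl then a - d else a) else a.+1)%N.

Let d_lt_a : (d < a)%N. Proof. by apply: leq_ltn_trans da; rewrite leq_addl. Qed.
Let pi0 : R := ln a.+1%:R - cst p d a R.

(** Greedy placement: if the image of a new vertex is drawn with weights [xopt], its expected
    logarithmic multiplicity to each placed vertex is exactly pi0. Some image does at least as well,
    so no error term arises. *)
Lemma exists_blowup_set n (U : {set 'I_n}) : exists f : 'I_n -> V,
  pi0 * 'C(#|U|, 2)%:R <=
  \sum_(A : {set 'I_n} | (A \subset U) && (#|A| == 2)) ln (P (f @: A))%:R.
Proof.
have [m] := ubnP #|U|; elim: m U => // m IHm U Um.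
have [U0|] := posnP #|U|.
  exists (fun=> vl); rewrite U0 mulr0 big1// => A /andP[AU /eqP A2].
  by have := subset_leq_card AU; rewrite U0 A2.
move=> /card_gt0P[v vU].
have cU : #|U| = #|(U :\ v)%SET|.+1 by rewrite (cardsD1 v U) vU.
have [f fP] := IHm (U :\ v)%SET ltac:(by rewrite -ltnS -cU).
have [w wP] : exists w, pi0 * #|(U :\ v)%SET|%:R <=
    \sum_(u in (U :\ v)%SET) log_mult R P (f u) w.
  have [/existsP//|] := boolP [exists w, pi0 * #|(U :\ v)%SET|%:R <=
    \sum_(u in (U :\ v)%SET) log_mult R P (f u) w].
  rewrite negb_exists => /forallP nw; exfalso.
  have h : \sum_w xopt p d a vl R w * (pi0 * #|(U :\ v)%SET|%:R -
      \sum_(u in (U :\ v)%SET) log_mult R P (f u) w) = 0.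
    rewrite (eq_bigr (fun w => xopt p d a vl R w * (pi0 * #|(U :\ v)%SET|%:R) -
       \sum_(u in (U :\ v)%SET) log_mult R P (f u) w * xopt p d a vl R w)); last first.
      by move=> w _; rewrite mulrBr mulr_sumr; congr (_ - _); apply: eq_bigr => u _; rewrite mulrC.
    rewrite sumrB -mulr_suml sum_xopt// mul1r exchange_big /=.
    rewrite (eq_bigr (fun=> pi0)); last first.
      by move=> u _; exact: sum_log_mult_xopt.
    by rewrite sumr_const mulr_natr subrr.
  have xP w : 0 < xopt p d a vl R w by rewrite divr_gt0 ?pv_gt0 ?cst_gt0.
  move/eqP: h; rewrite psumr_eq0; last first.
    by move=> w _; rewrite mulr_ge0 ?ltW// subr_gt0 ltNge.
  move=> /allP/(_ vl); rewrite mem_index_enum => /(_ isT) /=.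
  by rewrite mulf_eq0 gt_eqF//= subr_eq0 => /eqP h; have := nw vl; rewrite -h lexx.
exists (fun u => if u == v then w else f u).
rewrite -{2}(finset.setD1K vU) big_pairs_setU1 /=; last by rewrite !inE eqxx.
rewrite cU binS bin1 natrD mulrDr addrC lerD//.
  apply: le_trans fP _; rewrite le_eqVlt; apply/orP; left; apply/eqP.
  apply: eq_bigr => A /andP[AU _]; congr (ln (P _)%:R); apply: eq_in_imset => u uA.
  by have := fintype.subsetP AU u uA; rewrite !inE => /andP[/negbTE ->].
apply: le_trans wP _; rewrite le_eqVlt; apply/orP; left; apply/eqP.
apply: eq_bigr => u; rewrite !inE => /andP[/negbTE uv _].
by rewrite /log_mult imsetU1 imset_set1 uv eqxx.
Qed.

Lemma blowup_gt0 n (f : {ffun 'I_n -> V}) (A : {set 'I_n}) :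
  #|A| = 2%N -> (0 < blowup P f A)%N.
Proof.
move=> /eqP/cards2P[x [y [_ ->]]]; rewrite blowupE P_pair.
by case: ifP => // _; case: ifP; rewrite ?subn_gt0//; lia.
Qed.

Let q := Sigma P s.
Let K : R := alpha R a * (slope R a d * (mu p s + 'C(s, 2) * q)%:R).

Lemma ex_prod_n_bounds n : (s <= n)%N ->
  expR (pi0 * 'C(n, 2)%:R) <= (ex_prod_n n s q)%:R <=
  expR (pi0 * 'C(n, 2)%:R + K * n%:R).
Proof.
move=> sn; have [[G Gq GE] ub] := @ex_prod_nP n s q sn; apply/andP; split.
  have [f fP] := @exists_blowup_set n [set: 'I_n]%SET.
  pose f' := [ffun i => f i].
  have fle : (edge_prod (blowup P f') [set: 'I_n]%SET <= ex_prod_n n s q)%N.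
    by apply: ub; exists (blowup P f') => //; exact: blowup_sq.
  apply: (@le_trans _ _ (edge_prod (blowup P f') [set: 'I_n]%SET)%:R); last first.
    by rewrite ler_nat.
  have e0 : 0 < (edge_prod (blowup P f') [set: 'I_n]%SET)%:R :> R.
    by rewrite ltr0n prodn_cond_gt0// => A /andP[_ /eqP]; exact: blowup_gt0.
  rewrite -[leRHS]lnK ?posrE// ler_expR ln_edge_prod; last exact: blowup_gt0.
  rewrite cardsT card_ord in fP; apply: le_trans fP _.
  rewrite le_eqVlt; apply/orP; left; apply/eqP; apply: eq_bigr => A _.
  by congr (ln (P _)%:R); apply: eq_imset => i; rewrite ffunE.
rewrite -GE; have [->|e0] := posnP (edge_prod G [set: 'I_n]%SET).
  exact: expR_ge0.
have G0 (A : {set 'I_n}) : #|A| = 2%N -> (0 < G A)%N.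
  move=> A2; rewrite lt0n; apply/eqP => GA; move: e0.
  by rewrite /edge_prod (bigD1 A) /= ?finset.subsetT ?A2//= GA mul0n.
rewrite -[leLHS]lnK ?posrE ?ltr0n// ler_expR.
apply: ln_edge_prod_le => //; first exact: Sigma_le P_pair p_gt0.
by move=> A; exact: sq_graph_pair_le Gq sn.
Qed.

Lemma ex_prod_patternE : ex_prod R s (Sigma P s) = expR (pi_pattern R P).
Proof.
rewrite (pi_patternE V_card P_pair R da) -/pi0 /ex_prod; apply/cvg_lim => //.
(* The error K n / C(n, 2) equals 2 K / (n - 1), which is at most 6 K / (n + 1) for n >= 2;
   [harmonic n] is 1 / (n + 1). *)
apply: (@squeeze_cvgr _ _ _ _ (fun=> expR pi0)
  (fun n : nat => expR (pi0 + 6 * K * harmonic n))).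
- near=> n.
  have sn : (s <= n)%N by near: n; exact: nbhs_infty_ge.
  have /andP[lo up] := ex_prod_n_bounds sn.
  have C0 : 0 < 'C(n, 2)%:R :> R by rewrite ltr0n bin_gt0; lia.
  have e0 : 0 < (ex_prod_n n s q)%:R :> R := lt_le_trans (expR_gt0 _) lo.
  have K0 : 0 <= K.
    apply: mulr_ge0; first exact/ltW/(alpha_gt0 R da).
    by apply: mulr_ge0 => //; exact: le_trans ler01 (slope_ge1 R da).
  have iC : 0 <= ('C(n, 2)%:R : R)^-1 by rewrite invr_ge0 ltW.
  have nn (x : R) : 0 < x -> x \is Num.nneg by rewrite nnegrE => /ltW.
  have lo' := ge0_ler_powR iC (nn _ (expR_gt0 _)) (nn _ e0) lo.
  have up' := ge0_ler_powR iC (nn _ e0) (nn _ (expR_gt0 _)) up.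
  rewrite -expRM mulfK ?gt_eqF// in lo'; rewrite lo' /=.
  apply: le_trans up' _; rewrite -expRM ler_expR mulrDl mulfK ?gt_eqF// lerD2l.
  rewrite -mulrA [6 * K]mulrC -[leRHS]mulrA; apply: ler_wpM2l => //; rewrite /harmonic /=.
  rewrite ler_pdivrMr// mulrAC ler_pdivlMr ?ltr0n//.
  rewrite -!natrM ler_nat; have := bin2_double n; move: sn; case: (n) => [|[|m]] //=; lia.
- exact: cvg_cst.
- apply: (@cvg_comp _ _ _ (fun n : nat => pi0 + 6 * K * harmonic n) (@expR R) _
    (nbhs pi0)); last exact: continuous_expR.
  have h : ((pi0 + 6 * K * harmonic n) @[n --> \oo] --> pi0 + 6 * K * 0)%classic.
    by apply: cvgD; [exact: cvg_cst|apply: cvgM; [exact: cvg_cst|exact: cvg_harmonic]].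
  by rewrite mulr0 addr0 in h.
Unshelve. all: by end_near.
Qed.

End Limit.

(** * Levels and multiplicities of the pattern of (r - 1, 0, ..., 0, 1) *)

Lemma sum_eq_ord n (j : 'I_n) : (\sum_(i < n) (i == j) = 1)%N.
Proof. by rewrite (bigD1 j)//= eqxx big1// => i /negbTE ->. Qed.

Lemma sumn_r_tuple p d : sumn (r_tuple p.+1 d) = p.+1.
Proof.
rewrite sumnE big_tuple.
rewrite (eq_bigr (fun i : 'I_d.+1 => p * (i == ord0) + (i == ord_max))%N).
  by rewrite big_split -big_distrr /= !sum_eq_ord muln1 addn1.
by move=> i _; rewrite tnth_mktuple.
Qed.

Lemma level_lt p d (v : 'I_(sumn (r_tuple p.+1 d))) : (v < p)%N ->
  reshape_index (r_tuple p.+1 d) v = 0%N.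
Proof.
move=> vp; have [//|j0] := posnP (reshape_index (r_tuple p.+1 d) v).
have /andP[+ _] := turan_levelP v.
rewrite (bigD1 ord0)// tnth_mktuple eqxx muln1 /= -addnA => h.
by have := leq_trans (leq_addr _ _) h; rewrite leqNgt vp.
Qed.

Lemma level_ge p d (v : 'I_(sumn (r_tuple p.+1 d))) : (p <= v)%N ->
  reshape_index (r_tuple p.+1 d) v = d.
Proof.
move=> pv; have /andP[_] := turan_levelP v.
have : (reshape_index (r_tuple p.+1 d) v < d.+1)%N.
  by rewrite -[X in (_ < X)%N](size_tuple (r_tuple p.+1 d)) reshape_indexP.
set j := reshape_index _ v; rewrite ltnS leq_eqVlt => /orP[/eqP//|jd].
suff : (\sum_(i < d.+1 | i <= j) tnth (r_tuple p.+1 d) i <= p)%N by move: pv; lia.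
apply: (@leq_trans (\sum_(i < d.+1) p * (i == ord0))); last first.
  by rewrite -big_distrr /= sum_eq_ord muln1.
rewrite big_mkcond; apply: leq_sum => i _; case: ifP => // ij.
rewrite tnth_mktuple (_ : (i == ord_max) = false) ?addn0//.
by apply/negP => /eqP iE; move: ij; rewrite iE /=; lia.
Qed.

(** The smaller vertex of a pair has index below p, hence level 0, so level d shows only in the loop
    at the last vertex. *)
Lemma turan_pairE p d a (lt_p : (p < sumn (r_tuple p.+1 d))%N)
    (u v : 'I_(sumn (r_tuple p.+1 d))) :
  turan_pattern a (r_tuple p.+1 d) [set u; v]%SET =
  (if u == v then (if v == Ordinal lt_p then a - d else a) else a.+1)%N.
Proof.
have ltp1 (w : 'I_(sumn (r_tuple p.+1 d))) : (w < p.+1)%N.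
  by rewrite -[X in (_ < X)%N](sumn_r_tuple p d).
have edge (x y : 'I_(sumn (r_tuple p.+1 d))) : (x < y)%N ->
    turan_pattern a (r_tuple p.+1 d) [set x; y]%SET = a.+1.
  move=> xy; rewrite turan_edge// level_lt ?subn0 ?addn1//.
  by have := ltp1 y; lia.
have [->|] := eqVneq u v; last first.
  rewrite -val_eqE /=; have [uv _|vu _|//] := ltngtP u v; first exact: edge.
  by rewrite finset.setUC edge.
rewrite finset.setUid turan_loop -val_eqE /=.
case: eqP => vp; first by rewrite level_ge ?vp.
by rewrite level_lt ?subn0// ltn_neqAle -ltnS ltp1 andbT; apply/eqP.
Qed.

Theorem theorem1p12 (R : realType) (r d a : nat)
    (hr : (2 <= r)%N) (ha : (d ^ 2 + d < a)%N) :
  let s := ((r - 1) * (d + 1) + 2)%N in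
  let T := turan_pattern a (r_tuple r d) in
  ex_prod R s (Sigma T s) = expR (pi_pattern R T).
Proof.
case: r hr => [//|p] hp /=.
have -> : ((p.+1 - 1) * (d + 1) + 2 = (p * d.+1).+2)%N by lia.
have lt_p : (p < sumn (r_tuple p.+1 d))%N by rewrite sumn_r_tuple.
apply: (@ex_prod_patternE R p d a _ _ (Ordinal lt_p)) => //.
  by rewrite card_ord sumn_r_tuple.
exact: turan_pairE.
Qed.
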